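(* Suppose the $\varepsilon$-decomposition assumption holds with $\mu=\mu_Q+\mu_R>0$ and the stochastic oracle assumption holds with $\rho=0$. Let $\kappa=L/\mu$ and $\varepsilon=L_R/L$. Run Local SGD on $M$ devices for $T=KH$ iterations from $x_0$. (i) If $T\le 2\kappa$, choose $\gamma_t=\frac{1}{6L}$ for all $t$. Then $$\mathbb{E}[F(\tilde x_T)-F(x_* )]=\mathcal{O}\left(L\exp\left(\frac{-\mu T}{L}\right)\|x_0-x_*\|^2+\frac{\sigma^2}{\mu T M}+\frac{\varepsilon L\sigma^2}{\mu^2 T K}\right),$$ where $\tilde x_T=\frac{1}{W_T}\sum_{t=0}^{T-1}w_t\bar x_t$, $w_t=\left(1-\frac{\mu}{6L}\right)^{-(t+1)}$, $W_T=\sum_{t=0}^{T-1}w_t$. (ii) If $T>2\kappa$, choose, with $\xi=\frac{12L}{\mu}-\frac{T}{2}$, $$\gamma_t=\begin{cases}\frac{1}{6L}, & t\le \frac{T}{2},\\ \frac{2}{\mu(\xi+t)}, & t>\frac{T}{2}.\end{cases}$$ Then $$\mathbb{E}[F(\tilde x_T)-F(x_* )]=\tilde{\mathcal{O}}\left(L\exp\left(\frac{-\mu T}{L}\right)\|x_0-x_*\|^2+\frac{\sigma^2}{\mu T M}+\frac{\varepsilon L\sigma^2}{\mu^2 T K}\right),$$ where $\tilde x_T=\frac{1}{W_T}\sum_{T/2\le t\le T-1}w_t\bar x_t$, $w_t=\xi+t$, $W_T=\sum_{T/2\le t\le T-1}w_t$.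
   Context: Problem: minimize $F(x)=\mathbb{E}_{z\sim\mathcal D}[F(x,z)]$ over $x\in\mathbb{R}^d$ (the same $F$ and $\mathcal D$ on all $M$ devices); $x_*$ denotes the minimizer of $F$. Norms are Euclidean. Notation: $\mathcal{O}$ omits constant factors; $\tilde{\mathcal{O}}$ omits polylogarithmic and constant factors. A function $f$ is $\mu$-strongly convex and $L$-smooth if $\frac{\mu}{2}\|x-y\|^2\le f(y)-f(x)-\langle\nabla f(x),y-x\rangle\le\frac{L}{2}\|x-y\|^2$ for all $x,y\in\mathbb{R}^d$. $\varepsilon$-decomposition assumption: $F=Q+R$, where $Q$ is a quadratic function that is $\mu_Q$-strongly convex and $L_Q$-smooth, $R$ is $\mu_R$-strongly convex and $L_R$-smooth, and $F$ is $L$-smooth. Stochastic oracle assumption: there are constants $\sigma,\rho$ such that for all $x$, $\mathbb{E}_{z\sim\mathcal D}[\nabla F(x,z)]=\nabla F(x)$ and $\mathbb{E}_{z\sim\mathcal D}\|\nabla F(x,z)-\nabla F(x)\|^2\le\sigma^2+\rho\|\nabla F(x)\|^2$. Local SGD: $x_0^m=x_0$ for $m=1,\dots,M$; $H$ is the number of local steps, $K$ the number of communication rounds, $T=KH$ the total number of iterations, $\gamma_t>0$ the stepsizes. For $t=0,\dots,T-1$, each device $m$ draws $z_t^m\sim\mathcal D$ (draws are independent) and sets $\mathbf g_t^m=\nabla F(x_t^m,z_t^m)$. If $H$ divides $t+1$, then $x_{t+1}^m=\frac1M\sum_{j=1}^M(x_t^j-\gamma_t\mathbf g_t^j)$ for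 all $m$; otherwise $x_{t+1}^m=x_t^m-\gamma_t\mathbf g_t^m$. Let $\bar x_t=\frac1M\sum_{m=1}^M x_t^m$.
   Formalization: In (ii) the exponential term is exp(-c μT/L) with a universal constant c>0, since with c=1 the bound fails for the prescribed stepsizes (e.g. F(x)=x²/2, σ=0, M=1, where the error decays only like (5/6)^T up to polynomial factors). *)

(* Defs.v *)
From HB Require Import structures.
From mathcomp Require Import all_boot all_order all_algebra.
From mathcomp Require Import all_classical all_reals all_analysis.

Set Implicit Arguments.
Unset Strict Implicit.
Unset Printing Implicit Defensive.

Import Order.TTheory GRing.Theory Num.Theory.
Import numFieldNormedType.Exports.

Local Open Scope classical_set_scope.
Local Open Scope ring_scope.

Definition inner (R : realType) (d : nat) (x y : 'rV[R]_d) : R :=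
  (x *m y^T) 0 0.

(* The library norm `|x| on row vectors is the sup norm; it induces the same
   topology, hence the same differentiability, as this one. *)
Definition enorm (R : realType) (d : nat) (x : 'rV[R]_d) : R :=
  Num.sqrt (inner x x).

Definition gradient (R : realType) (d : nat) (f : 'rV[R]_d -> R)
    (x : 'rV[R]_d) : 'rV[R]_d :=
  \row_(i < d) 'D_(delta_mx 0 i) f x.

(* Strong convexity allows mu = 0, i.e. plain convexity, but not mu < 0. *)
Definition strongly_convex (R : realType) (d : nat) (mu : R)
    (f : 'rV[R]_d -> R) : Prop :=
  [/\ 0 <= mu,
      (forall x, differentiable f x) &
      forall x y, mu / 2 * enorm (x - y) ^+ 2
                  <= f y - f x - inner (gradient f x) (y - x)].

Definition smooth (R : realType) (d : nat) (L : R)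
    (f : 'rV[R]_d -> R) : Prop :=
  (forall x, differentiable f x) /\
  forall x y, f y - f x - inner (gradient f x) (y - x)
              <= L / 2 * enorm (x - y) ^+ 2.

Definition quadratic (R : realType) (d : nat) (f : 'rV[R]_d -> R) : Prop :=
  exists (A : 'M[R]_d) (b : 'rV[R]_d) (c : R),
    forall x, f x = inner (x *m A) x + inner b x + c.

Definition eps_decomposition (R : realType) (d : nat) (F : 'rV[R]_d -> R)
    (muQ LQ muR LR L : R) : Prop :=
  exists Qf Rf : 'rV[R]_d -> R,
    [/\ (forall x, F x = Qf x + Rf x),
        [/\ quadratic Qf, strongly_convex muQ Qf & smooth LQ Qf],
        strongly_convex muR Rf /\ smooth LR Rf &
        smooth L F].

(* F x = E_{z ~ D} [f x z] *)
Definition expected_objective (R : realType) (d : nat) (dZ : measure_display)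
    (Z : measurableType dZ) (D : probability Z R)
    (f : 'rV[R]_d -> Z -> R) (F : 'rV[R]_d -> R) : Prop :=
  forall x, D.-integrable setT (EFin \o f x) /\ ('E_D[f x] = (F x)%:E)%E.

Definition stoch_grad (R : realType) (d : nat) (Z : Type)
    (f : 'rV[R]_d -> Z -> R) (x : 'rV[R]_d) (z : Z) : 'rV[R]_d :=
  gradient (fun y => f y z) x.

(* The vector identity E[grad f(x, z)] = grad F(x) is read coordinatewise. *)
Definition stochastic_oracle (R : realType) (d : nat) (dZ : measure_display)
    (Z : measurableType dZ) (D : probability Z R)
    (f : 'rV[R]_d -> Z -> R) (F : 'rV[R]_d -> R) (sigma rho : R) : Prop :=
  [/\ (forall x z, differentiable (fun y => f y z) x),
      (forall x (i : 'I_d),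
         D.-integrable setT (EFin \o (fun z => stoch_grad f x z 0 i)) /\
         ('E_D[fun z => (stoch_grad f x z 0 i)%R] = (gradient F x 0 i)%:E)%E) &
      forall x,
        ('E_D[fun z => (enorm (stoch_grad f x z - gradient F x) ^+ 2)%R]
         <= (sigma ^+ 2 + rho * enorm (gradient F x) ^+ 2)%R%:E)%E].

Definition mutually_independent (R : realType) (dO dZ : measure_display)
    (Omega : measurableType dO) (Z : measurableType dZ)
    (P : probability Omega R) (I : finType) (X : I -> Omega -> Z) : Prop :=
  forall (J : {set I}) (A : I -> set Z),
    (forall i, measurable (A i)) ->
    (P (\bigcap_(i in [set` J]) (X i @^-1` A i))
     = \prod_(i in J) P (X i @^-1` A i))%E.

(* The draws zeta t m for t < T are i.i.d. with law D; later ones are unused. *)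
Definition iid_draws (R : realType) (dO dZ : measure_display)
    (Omega : measurableType dO) (Z : measurableType dZ)
    (P : probability Omega R) (D : probability Z R) (T M : nat)
    (zeta : nat -> 'I_M -> {RV P >-> Z}) : Prop :=
  (forall t m, (t < T)%N -> forall A, measurable A ->
     distribution P (zeta t m) A = D A) /\
  mutually_independent P
    (fun (i : 'I_T * 'I_M) omega => zeta i.1 i.2 omega).

Fixpoint local_sgd (R : realType) (d M : nat) (Z : Type)
    (G : 'rV[R]_d -> Z -> 'rV[R]_d) (H : nat) (gamma : nat -> R)
    (x0 : 'rV[R]_d) (z : nat -> 'I_M -> Z) (t : nat) : 'I_M -> 'rV[R]_d :=
  if t is s.+1 then
    let x := local_sgd G H gamma x0 z s in
    let y m := x m - gamma s *: G (x m) (z s m) in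
    if (H %| s.+1)%N then fun=> M%:R^-1 *: \sum_(j < M) y j else y
  else fun=> x0.

Definition local_sgd_mean (R : realType) (d M : nat) (Z : Type)
    (G : 'rV[R]_d -> Z -> 'rV[R]_d) (H : nat) (gamma : nat -> R)
    (x0 : 'rV[R]_d) (z : nat -> 'I_M -> Z) (t : nat) : 'rV[R]_d :=
  M%:R^-1 *: \sum_(m < M) local_sgd G H gamma x0 z t m.

Definition weighted_avg (R : realType) (d : nat) (T : nat) (p : pred nat)
    (w : nat -> R) (x : nat -> 'rV[R]_d) : 'rV[R]_d :=
  (\sum_(0 <= t < T | p t) w t)^-1 *: \sum_(0 <= t < T | p t) w t *: x t.

Definition gamma_const (R : realType) (L : R) : nat -> R := fun=> (6 * L)^-1.

Definition weight_const (R : realType) (mu L : R) : nat -> R :=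
  fun t => (1 - mu / (6 * L)) ^- t.+1.

Definition xi_dec (R : realType) (mu L : R) (T : nat) : R :=
  12 * L / mu - T%:R / 2.

Definition gamma_dec (R : realType) (mu L : R) (T : nat) : nat -> R :=
  fun t => if t%:R <= T%:R / 2 :> R then (6 * L)^-1
           else 2 / (mu * (xi_dec mu L T + t%:R)).

Definition weight_dec (R : realType) (mu L : R) (T : nat) : nat -> R :=
  fun t => xi_dec mu L T + t%:R.

(* Main.v *)
Require Import Defs.
From HB Require Import structures.
From mathcomp Require Import all_boot all_order all_algebra.
From mathcomp Require Import all_classical all_reals all_analysis.
From mathcomp Require Import measurable_realfun.
From mathcomp Require Import zify ring lra.

Set Implicit Arguments.
Unset Strict Implicit.
Unset Printing Implicit Defensive.

Import Order.TTheory GRing.Theory Num.Theory.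
Import numFieldNormedType.Exports.

Local Open Scope classical_set_scope.
Local Open Scope ring_scope.

(** Write [F = Q + S] with [Q] quadratic and [S] the remainder, [xb] for the mean
    of the local iterates [x m], [r] for the expectation of [|xb - xstar|^2], [e]
    for that of [F xb - F xstar] and [V] for that of the dispersion, the mean
    over the devices of [|x m - xb|^2]. Everything follows from two scalar
    recursions.

    The mean of the local gradients of [Q] is exactly [gradient Q xb], because
    the gradient of a quadratic function is affine. Hence local steps cost
    something only through [S], and convexity and smoothness of [S] bound this
    cost by [LS * V]; a gradient step along the mean of the local gradients gives
    ([mean_gradient_step], [mean_sqr_dist_step])
      [r' <= (1 - g * mu) * r - 4 / 3 * g * e + 4 / 3 * g * LS * V
              + g ^ 2 * sigma ^ 2 / M].
    All devices minimize the same strongly convex function, so a gradient step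
    contracts pairwise distances ([gradient_step_contraction]) and only the noise
    makes the iterates drift apart ([mean_disp_step]):
      [V' <= (1 - g * mu) * V + g ^ 2 * sigma ^ 2],
    with [V' = 0] at a communication.

    The cross terms vanish in expectation because the draw of one device at one
    step is independent of the sigma-algebra of all other draws. The joint law of
    this sigma-algebra and of the draw is a product measure, and Fubini's theorem
    reduces expectations to the oracle at a fixed point ([fresh_draw_integral_eq0],
    [fresh_draw_integral_le]). This uses the joint measurability of the stochastic
    gradient, a limit of difference quotients of a function that is continuous in
    the point and measurable in the draw ([measurable_caratheodory],
    [measurable_gradient]).

    With step sizes [g t = 2 / (mu * s t)], where [s] starts at [12 * L / mu] and
    grows by at most one per step, the recursion on [V] says that [V t * s t ^ 2]
    grows by at most a constant per step, whence
    [V t <= 5 * sigma ^ 2 * H / (mu * s t) ^ 2] ([dispersion_bound]). With a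
    constant [s], weights [(1 - mu / (6 * L)) ^ - (t + 1)] telescope the recursion
    on [r], and [expR (- mu * T / L)] is bounded below as long as [T] is at most
    [2 * L / mu] ([few_steps_rate]). Otherwise, the first half of the steps
    contracts [r] exponentially ([first_phase]), and [s ^ 2 * r] telescopes in the
    second half ([second_phase]); the logarithm comes from the sum of the
    [1 / s t] ([many_steps_rate]). Jensen's inequality turns weighted sums of the
    [e t] into a bound on the average iterate ([weighted_avg_gap]). *)

(** * Inner products and means over the devices *)

Section inner_product.
Variables (R : realType) (d : nat).
Implicit Types (x y z v : 'rV[R]_d) (a : R).

Lemma innerE x y : inner x y = \sum_(i < d) x 0 i * y 0 i.
Proof. by rewrite /inner mxE; apply: eq_bigr => i _; rewrite mxE. Qed.

Lemma innerC x y : inner x y = inner y x.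
Proof. by rewrite !innerE; apply: eq_bigr => i _; rewrite mulrC. Qed.

Lemma innerDl x y z : inner (x + y) z = inner x z + inner y z.
Proof. by rewrite /inner mulmxDl mxE. Qed.

Lemma innerDr x y z : inner z (x + y) = inner z x + inner z y.
Proof. by rewrite innerC innerDl !(innerC z). Qed.

Lemma innerZl a x y : inner (a *: x) y = a * inner x y.
Proof. by rewrite /inner -scalemxAl mxE. Qed.

Lemma innerZr a x y : inner x (a *: y) = a * inner x y.
Proof. by rewrite innerC innerZl innerC. Qed.

Lemma innerNl x y : inner (- x) y = - inner x y.
Proof. by rewrite -scaleN1r innerZl mulN1r. Qed.

Lemma innerNr x y : inner x (- y) = - inner x y.
Proof. by rewrite innerC innerNl innerC. Qed.

Lemma inner0l x : inner 0 x = 0.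
Proof. by rewrite -(scale0r 0) innerZl mul0r. Qed.

Lemma inner_suml (I : Type) (s : seq I) (P : pred I) (F : I -> 'rV[R]_d) y :
  inner (\sum_(i <- s | P i) F i) y = \sum_(i <- s | P i) inner (F i) y.
Proof.
elim/big_rec2: _ => [|i a v _ <-]; first exact: inner0l.
by rewrite innerDl.
Qed.

Lemma inner_delta x i : inner x (delta_mx 0 i) = x 0 i.
Proof.
rewrite innerE (bigD1 i) //= mxE !eqxx mulr1 big1 ?addr0// => j ji.
by rewrite mxE eqxx (negPf ji) mulr0.
Qed.

Lemma inner_ge0 x : 0 <= inner x x.
Proof. by rewrite innerE; apply: sumr_ge0 => i _; rewrite -expr2 sqr_ge0. Qed.

Lemma enorm_sqr x : enorm x ^+ 2 = inner x x.
Proof. by rewrite /enorm sqr_sqrtr ?inner_ge0. Qed.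

Lemma inner_mulmx x y (A : 'M[R]_d) : inner (x *m A) y = inner x (y *m A^T).
Proof. by rewrite /inner trmx_mul trmxK mulmxA. Qed.

Lemma inner_sqrD x y :
  inner (x + y) (x + y) = inner x x + 2 * inner x y + inner y y.
Proof. by rewrite innerDl !innerDr (innerC y x); ring. Qed.

Lemma inner_sqrB x y :
  inner (x - y) (x - y) = inner x x - 2 * inner x y + inner y y.
Proof. by rewrite inner_sqrD innerNl !innerNr; ring. Qed.

Lemma inner_sqr_step x v a : inner (x - a *: v) (x - a *: v) =
  inner x x - 2 * (a * inner v x) + a * (a * inner v v).
Proof. by rewrite inner_sqrB !innerZr innerZl (innerC x). Qed.

Lemma inner_sqr_swap x y : inner (x - y) (x - y) = inner (y - x) (y - x).
Proof. by rewrite !inner_sqrB (innerC y); ring. Qed.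

End inner_product.

(* Expansion of inner products of linear combinations. *)
Definition inner_expand R d := (@innerDl R d, @innerDr R d, @innerZl R d,
  @innerZr R d, @innerNl R d, @innerNr R d).

Section means.
Variables (R : realType) (d M : nat).
Hypothesis M_gt0 : (0 < M)%N.
Implicit Types (v : 'I_M -> 'rV[R]_d) (a b : 'I_M -> R) (c : 'rV[R]_d).

(** Means over the [M] devices, of vectors and of numbers. *)
Definition vmean v : 'rV[R]_d := M%:R^-1 *: \sum_(m < M) v m.
Definition smean a : R := M%:R^-1 * \sum_(m < M) a m.

Lemma smeanD a b : smean (fun m => a m + b m) = smean a + smean b.
Proof. by rewrite /smean big_split mulrDr. Qed.

Lemma smeanZ r a : smean (fun m => r * a m) = r * smean a.
Proof. by rewrite /smean -mulr_sumr mulrCA. Qed.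

Lemma smean_cst r : smean (fun=> r) = r.
Proof.
rewrite /smean sumr_const card_ord -[r *+ M]mulr_natl mulrA mulVf ?mul1r//.
by rewrite pnatr_eq0 -lt0n.
Qed.

Lemma smean_le a b : (forall m, a m <= b m) -> smean a <= smean b.
Proof. by move=> ab; rewrite /smean ler_wpM2l ?invr_ge0// ler_sum. Qed.

Lemma smean_ge0 a : (forall m, 0 <= a m) -> 0 <= smean a.
Proof. by move=> a0; rewrite /smean mulr_ge0 ?invr_ge0// sumr_ge0. Qed.

Lemma eq_smean a b : a =1 b -> smean a = smean b.
Proof. by move=> ab; rewrite /smean; congr (_ * _); apply: eq_bigr => i _. Qed.

Lemma vmeanB v w : vmean (fun m => v m - w m) = vmean v - vmean w.
Proof. by rewrite /vmean sumrB scalerBr. Qed.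

Lemma vmeanZ r v : vmean (fun m => r *: v m) = r *: vmean v.
Proof. by rewrite /vmean -scaler_sumr !scalerA mulrC. Qed.

Lemma vmean_cst c : vmean (fun=> c) = c.
Proof.
rewrite /vmean sumr_const card_ord -[c *+ M]scaler_nat scalerA mulVf ?scale1r//.
by rewrite pnatr_eq0 -lt0n.
Qed.

Lemma inner_vmeanl v c : inner (vmean v) c = smean (fun m => inner (v m) c).
Proof. by rewrite innerZl inner_suml. Qed.

(** Bias-variance decomposition of the mean squared distance to a point. *)
Lemma smean_sqr_dist v c :
  smean (fun m => inner (v m - c) (v m - c)) =
  inner (vmean v - c) (vmean v - c)
  + smean (fun m => inner (v m - vmean v) (v m - vmean v)).
Proof.
set w := vmean v.
have E m : inner (v m - c) (v m - c) = inner (w - c) (w - c) +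
    (inner (v m - w) (v m - w) +
     (2 * inner (v m) (w - c) + (- 2 * inner w (w - c)))).
  by rewrite !inner_sqrB !innerDr !innerNr; ring.
rewrite (eq_smean E) !smeanD !smean_cst smeanZ -inner_vmeanl -/w; ring.
Qed.

Lemma smean_sqr_vmean v c :
  inner (vmean v - c) (vmean v - c) <= smean (fun m => inner (v m - c) (v m - c)).
Proof.
by rewrite smean_sqr_dist lerDl; apply: smean_ge0 => m; exact: inner_ge0.
Qed.

Lemma smean_sqr_center v :
  smean (fun m => inner (v m - vmean v) (v m - vmean v))
  <= smean (fun m => inner (v m) (v m)).
Proof.
have := smean_sqr_dist v 0; rewrite !subr0.
under [in X in X = _ -> _]eq_smean => m do rewrite subr0.
by move=> ->; rewrite lerDr inner_ge0.
Qed.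

(** The mean squared distance of pairs is twice the dispersion; this transfers
    the contraction of pairwise distances to the dispersion. *)
Lemma smean_sqr_pairs v :
  smean (fun n => smean (fun m => inner (v m - v n) (v m - v n))) =
  2 * smean (fun m => inner (v m - vmean v) (v m - vmean v)).
Proof.
under eq_smean => n do rewrite smean_sqr_dist.
rewrite smeanD smean_cst mulr_natl mulr2n; congr (_ + _).
by apply: eq_smean => m; exact: inner_sqr_swap.
Qed.

End means.

(** * Convexity and smoothness *)

Section bregman.
Variables (R : realType) (d : nat).
Implicit Types (f : 'rV[R]_d -> R) (x y : 'rV[R]_d).

(** Bregman divergence: the gap at [y] between [f] and its linearization at
    [x]. *)
Definition breg f x y : R := f y - f x - inner (gradient f x) (y - x).

(** Jensen's inequality for a weighted average. *)
Lemma breg_jensen f (I : Type) (s : seq I) (p : pred I) (wt : I -> R)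
    (x : I -> 'rV[R]_d) (W := \sum_(i <- s | p i) wt i) :
  (forall x y, 0 <= breg f x y) -> (forall i, p i -> 0 <= wt i) -> 0 < W ->
  W * f (W^-1 *: \sum_(i <- s | p i) wt i *: x i) <= \sum_(i <- s | p i) wt i * f (x i).
Proof.
move=> cv wt0 W0; set xt := W^-1 *: _.
have h : 0 <= \sum_(i <- s | p i) wt i * breg f xt (x i).
  by apply: sumr_ge0 => i pi; rewrite mulr_ge0// wt0.
rewrite -subr_ge0; apply: le_trans h _; rewrite le_eqVlt; apply/orP; left; apply/eqP.
have E i : wt i * breg f xt (x i) = wt i * f (x i) - wt i * f xt
    - (inner (wt i *: x i) (gradient f xt) - wt i * inner xt (gradient f xt)).
  by rewrite /breg innerZl innerDr innerNr !(innerC (gradient f xt)); ring.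
rewrite (eq_bigr _ (fun i _ => E i)) !sumrB -!mulr_suml -/W -inner_suml.
have -> : \sum_(i <- s | p i) wt i *: x i = W *: xt.
  by rewrite /xt scalerA divff ?scale1r// gt_eqF.
by rewrite innerZl subrr subr0.
Qed.

(** Co-coercivity: a convex [L]-smooth function controls the variation of its
    gradient by its Bregman divergence. *)
Lemma breg_cocoercive f (L : R) : 0 < L -> (forall x y, 0 <= breg f x y) ->
  (forall x y, breg f x y <= L / 2 * inner (x - y) (x - y)) ->
  forall x y, inner (gradient f x - gradient f y) (gradient f x - gradient f y)
              <= 2 * L * breg f x y.
Proof.
move=> L0 cv sm x y.
set g := gradient f x - gradient f y.
(* a gradient step from [y] for the tilted function [f - inner (gradient f x)] *)
pose z := y + L^-1 *: g.
have h1 := cv x z; have h2 := sm y z.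
have Lg : L * inner (L^-1 *: g) (L^-1 *: g) = L^-1 * inner g g.
  by rewrite innerZl innerZr mulVKf// gt_eqF.
have yz : inner (y - z) (y - z) = inner (L^-1 *: g) (L^-1 *: g).
  by rewrite /z opprD addrA subrr sub0r innerNl innerNr opprK.
rewrite yz in h2.
have E1 : inner (gradient f x) (z - x) =
    inner (gradient f x) (y - x) + L^-1 * inner (gradient f x) g.
  by rewrite /z !inner_expand; ring.
have E2 : inner (gradient f y) (z - y) = L^-1 * inner (gradient f y) g.
  by rewrite /z addrAC subrr add0r innerZr.
have gg : inner g g = inner (gradient f x) g - inner (gradient f y) g.
  by rewrite {1}/g innerDl innerNl.
have hb : L^-1 * inner g g <= 2 * breg f x y.
  have eg : L^-1 * inner g g =
      L^-1 * inner (gradient f x) g - L^-1 * inner (gradient f y) g.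
    by rewrite gg mulrBr.
  move: h1 h2; rewrite {1 2}/breg E1 E2 {1}/breg => h1 h2; lra.
rewrite -[leLHS](mulVKf (lt0r_neq0 L0)) (mulrC 2) -mulrA.
by rewrite ler_wpM2l// ltW.
Qed.

Lemma gradient_suboptimality f (L : R) xstar : 0 < L ->
  (forall x y, breg f x y <= L / 2 * inner (x - y) (x - y)) ->
  (forall x, f xstar <= f x) ->
  forall x, inner (gradient f x) (gradient f x) <= 2 * L * (f x - f xstar).
Proof.
move=> L0 sm mn x; set g := gradient f x.
(* compare the minimum with the value after a gradient step *)
have h1 := mn (x - L^-1 *: g); have := sm x (x - L^-1 *: g).
have -> : x - (x - L^-1 *: g) = L^-1 *: g by rewrite opprB addrCA subrr addr0.
rewrite /breg [x - _ - x]addrAC subrr add0r -/g innerNr !innerZr innerZl => h2.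
have h3 : L / 2 * (L^-1 * (L^-1 * inner g g)) = L^-1 * inner g g / 2.
  by field; rewrite gt_eqF.
have h4 : L^-1 * inner g g <= 2 * (f x - f xstar) by lra.
rewrite -[leLHS](mulVKf (lt0r_neq0 L0)) (mulrC 2) -mulrA.
by rewrite ler_wpM2l// ltW.
Qed.

(** A gradient step on a [mu]-strongly convex [L]-smooth function contracts
    squared distances by [1 - g * mu]. *)
Lemma gradient_step_contraction f (mu L g : R) : 0 < L -> 0 <= mu ->
  (forall x y, mu / 2 * inner (x - y) (x - y) <= breg f x y) ->
  (forall x y, breg f x y <= L / 2 * inner (x - y) (x - y)) ->
  0 <= g -> g * L <= 1 ->
  forall x y,
    inner ((x - g *: gradient f x) - (y - g *: gradient f y))
          ((x - g *: gradient f x) - (y - g *: gradient f y))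
    <= (1 - g * mu) * inner (x - y) (x - y).
Proof.
move=> L0 mu0 sc sm g0 gL x y.
have cv u v : 0 <= breg f u v.
  by apply: le_trans (sc u v); rewrite mulr_ge0 ?inner_ge0// divr_ge0.
(* one divergence controls the gradients, the other one the distance *)
have h1 := breg_cocoercive L0 cv sm x y; have h2 := sc y x.
set a := gradient f x in h1 *; set b := gradient f y in h1 *.
set N := inner (a - b) (a - b) in h1.
have -> : x - g *: a - (y - g *: b) = (x - y) - g *: (a - b).
  by rewrite scalerBr !opprB addrACA [RHS]addrACA (addrC (- y)).
rewrite (inner_sqr_step (x - y)) -/N.
have e : inner (a - b) (x - y) = breg f x y + breg f y x.
  by rewrite /breg -/a -/b -(opprB x y) !(innerDl, innerNl, innerNr); ring.
have yx : inner (y - x) (y - x) = inner (x - y) (x - y).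
  exact: inner_sqr_swap.
rewrite yx in h2.
have N0 : 0 <= N by exact: inner_ge0.
have i1 : g * (g * N) <= 2 * g * breg f x y.
  apply: (@le_trans _ _ (g * (g * (2 * L * breg f x y)))).
    by rewrite !ler_wpM2l.
  have -> : g * (g * (2 * L * breg f x y)) = (g * L) * (2 * g * breg f x y).
    by ring.
  by rewrite ler_piMl// ?mulr_ge0// ?cv.
have i2 : g * (mu / 2 * inner (x - y) (x - y)) <= g * breg f y x.
  by rewrite ler_wpM2l.
rewrite e; lra.
Qed.

Lemma gradientD f h x : differentiable f x -> differentiable h x ->
  gradient (fun y => f y + h y) x = gradient f x + gradient h x.
Proof.
move=> df dh; apply/rowP => i; rewrite !mxE.
by rewrite [LHS](@deriveD _ _ _ f h)//; exact: diff_derivable.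
Qed.

Lemma linear_coef_eq0 (a q : R) : (forall t, 0 <= t * a + t ^+ 2 * q) -> a = 0.
Proof.
move=> h; apply/eqP; apply: contraT => a0.
pose k := `|q| + 1.
have k0 : 0 < k by rewrite ltr_wpDl.
have := h (- a / k).
have -> : - a / k * a + (- a / k) ^+ 2 * q = (a / k) ^+ 2 * (q - k).
  by field; rewrite gt_eqF.
rewrite pmulr_rge0; last by rewrite exprn_even_gt0//= mulf_neq0// invr_neq0// gt_eqF.
by rewrite subr_ge0 => kq; have := ler_norm q; rewrite /k in kq; lra.
Qed.

(** The gradient of a convex quadratic function is affine, hence commutes with
    means. *)
Lemma gradient_quadratic_vmean f M (v : 'I_M -> 'rV[R]_d) : (0 < M)%N ->
  quadratic f -> (forall x y, 0 <= breg f x y) ->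
  gradient f (vmean v) = vmean (fun m => gradient f (v m)).
Proof.
move=> M0 [A [b [c fE]]] cv.
have gE x i : gradient f x 0 i =
    inner x (delta_mx 0 i *m A^T + delta_mx 0 i *m A) + b 0 i.
  set e := delta_mx 0 i.
  apply/eqP; rewrite -subr_eq0; apply/eqP/oppr_inj; rewrite oppr0.
  apply: (@linear_coef_eq0 _ (inner (e *m A) e)) => t.
  have := cv x (x + t *: e); rewrite /breg !fE [x + _ - x]addrAC subrr add0r.
  rewrite -inner_delta -/e mulmxDl -scalemxAl !inner_expand (inner_mulmx x e).
  rewrite -inner_delta -/e (innerC (e *m A) x) => h.
  by apply: le_trans h _; rewrite le_eqVlt; apply/orP; left; apply/eqP; ring.
apply/rowP => i; rewrite gE inner_vmeanl.
rewrite mxE summxE -[LHS]/(smean _ + _) -(smean_cst M0 (b 0 i)) -smeanD.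
by rewrite /smean; congr (_ * _); apply: eq_bigr => m _; rewrite gE.
Qed.

End bregman.

(** * One deterministic step *)
Section deterministic_step.
Variables (R : realType) (d M : nat) (F Q S : 'rV[R]_d -> R).
Variables (muQ muS LS L g : R) (xstar : 'rV[R]_d).
Hypothesis M_gt0 : (0 < M)%N.
Hypothesis FE : forall x, F x = Q x + S x.
Hypothesis gradFE : forall x, gradient F x = gradient Q x + gradient S x.
Hypothesis Q_quadratic : quadratic Q.
Hypotheses (muQ_ge0 : 0 <= muQ) (muS_ge0 : 0 <= muS) (L_gt0 : 0 < L).
Hypothesis Q_convex : forall x y, muQ / 2 * inner (x - y) (x - y) <= breg Q x y.
Hypothesis S_convex : forall x y, muS / 2 * inner (x - y) (x - y) <= breg S x y.
Hypothesis S_smooth : forall x y, breg S x y <= LS / 2 * inner (x - y) (x - y).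
Hypothesis F_smooth : forall x y, breg F x y <= L / 2 * inner (x - y) (x - y).
Hypothesis F_min : forall x, F xstar <= F x.
Hypotheses (g_ge0 : 0 <= g) (gL : 6 * (g * L) <= 1).
Let mu := muQ + muS.

Lemma bregE x y : breg F x y = breg Q x y + breg S x y.
Proof. by rewrite /breg !FE gradFE innerDl; ring. Qed.

Let Q_ge0 x y : 0 <= breg Q x y.
Proof.
by apply: le_trans (Q_convex x y); rewrite mulr_ge0 ?inner_ge0// divr_ge0.
Qed.

Let S_ge0 x y : 0 <= breg S x y.
Proof.
by apply: le_trans (S_convex x y); rewrite mulr_ge0 ?inner_ge0// divr_ge0.
Qed.

Lemma F_strongly_convex x y : mu / 2 * inner (x - y) (x - y) <= breg F x y.
Proof.
by rewrite bregE; have := Q_convex x y; have := S_convex x y; rewrite /mu; lra.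
Qed.

(** The remainder [S] inherits the smoothness constant of [F], since [Q] is
    convex; this gives the product [L * LS] instead of [LS ^+ 2], without any
    comparison between [LS] and [L]. *)
Lemma remainder_gradient_variation x y :
  inner (gradient S x - gradient S y) (gradient S x - gradient S y)
  <= L * LS * inner (x - y) (x - y).
Proof.
have SL u v : breg S u v <= L / 2 * inner (u - v) (u - v).
  by apply: le_trans (F_smooth u v); rewrite bregE lerDr.
apply: (le_trans (breg_cocoercive L_gt0 S_ge0 SL x y)).
have := S_smooth x y; rewrite -(ler_pM2l L_gt0) => h; lra.
Qed.

Variable x : 'I_M -> 'rV[R]_d.
Let xb := vmean x.
Let gb := vmean (fun m => gradient F (x m)).
Let V := smean (fun m => inner (x m - xb) (x m - xb)).

(** Convexity of [Q] is used at the mean [xb] and that of [S] at each [x m]. *)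
Lemma mean_gradient_descent :
  F xb - F xstar + mu / 2 * inner (xb - xstar) (xb - xstar) - LS / 2 * V
  <= inner gb (xb - xstar).
Proof.
have gbE : gb = gradient Q xb + vmean (fun m => gradient S (x m)).
  rewrite /xb gradient_quadratic_vmean// /gb /vmean -scalerDr -big_split.
  by congr (_ *: _); apply: eq_bigr => m _; rewrite gradFE.
rewrite gbE (innerDl (gradient Q xb)) (inner_vmeanl (fun m => gradient S (x m))).
have hS m : S xb - S xstar + (muS / 2 * inner (x m - xstar) (x m - xstar)
    + - (LS / 2) * inner (x m - xb) (x m - xb))
    <= inner (gradient S (x m)) (xb - xstar).
  have := S_smooth (x m) xb; have := S_convex (x m) xstar.
  by rewrite /breg !(innerDr _ _ (gradient S _)) !innerNr; lra.
have := smean_le hS; rewrite !smeanD !smeanZ !smean_cst// -/V.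
have jensen := smean_sqr_vmean M_gt0 x xstar; rewrite -/xb in jensen.
have := ler_wpM2l (divr_ge0 muS_ge0 (ler0n R 2)) jensen.
have := Q_convex xb xstar.
by rewrite /breg !(innerDr _ _ (gradient Q _)) !innerNr !FE /mu; lra.
Qed.

Lemma mean_gradient_norm :
  inner gb gb <= 4 * L * (F xb - F xstar) + 2 * (L * LS * V).
Proof.
set D := gb - gradient F xb.
have gbE : inner gb gb <=
    2 * inner (gradient F xb) (gradient F xb) + 2 * inner D D.
  have := inner_ge0 (gradient F xb - D).
  have -> : gb = gradient F xb + D by rewrite /D addrC subrK.
  by rewrite inner_sqrB inner_sqrD; lra.
have DD : inner D D <= L * LS * V.
  have DE : D = vmean (fun m => gradient S (x m) - gradient S xb).
    rewrite vmeanB vmean_cst// /D gradFE /xb gradient_quadratic_vmean// -/xb.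
    rewrite opprD addrA; congr (_ - _); rewrite /gb -vmeanB /vmean.
    congr (_ *: _); apply: eq_bigr => m _.
    by rewrite gradFE addrAC subrr add0r.
  rewrite /V -smeanZ DE -[vmean _]subr0.
  apply: le_trans (smean_sqr_vmean M_gt0 _ _) _.
  by apply: smean_le => m; rewrite subr0; exact: remainder_gradient_variation.
have := gradient_suboptimality L_gt0 F_smooth F_min xb.
lra.
Qed.

(** Effect of one step along the mean of the local gradients, up to the
    dispersion [V] of the local iterates, which is multiplied by [LS] only. *)
Lemma mean_gradient_step :
  inner (xb - g *: gb - xstar) (xb - g *: gb - xstar)
  <= (1 - g * mu) * inner (xb - xstar) (xb - xstar)
     - 4 / 3 * g * (F xb - F xstar) + 4 / 3 * g * (LS * V).
Proof.
have -> : xb - g *: gb - xstar = (xb - xstar) - g *: gb by rewrite addrAC.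
rewrite (inner_sqr_step (xb - xstar)).
have h1 := ler_wpM2l g_ge0 mean_gradient_descent.
have h2 := ler_wpM2l g_ge0 (ler_wpM2l g_ge0 mean_gradient_norm).
have e0 : 0 <= F xb - F xstar by rewrite subr_ge0.
have V0 : 0 <= LS * V.
  rewrite /V -smeanZ; apply: smean_ge0 => m.
  by have := le_trans (S_ge0 _ _) (S_smooth (x m) xb); lra.
have h3 : 6 * (g * L) * (g * (F xb - F xstar)) <= g * (F xb - F xstar).
  by rewrite ler_piMl// mulr_ge0.
have h4 : 6 * (g * L) * (g * (LS * V)) <= g * (LS * V).
  by rewrite ler_piMl// mulr_ge0.
lra.
Qed.

Let y m := x m - g *: gradient F (x m).

(** The dispersion contracts along the local gradient steps. *)
Lemma dispersion_gradient_step :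
  smean (fun m => inner (y m - vmean y) (y m - vmean y)) <= (1 - g * mu) * V.
Proof.
have gL0 : 0 <= g * L by rewrite mulr_ge0// ltW.
have gL1 : g * L <= 1 by have := gL; lra.
have mu0 : 0 <= mu by rewrite addr_ge0.
rewrite -(ler_pM2l (ltr0n R 2)) -smean_sqr_pairs// mulrCA /V -smean_sqr_pairs//.
rewrite -smeanZ; apply: smean_le => n; rewrite -smeanZ; apply: smean_le => m.
apply: (gradient_step_contraction L_gt0 mu0) => //.
exact: F_strongly_convex.
Qed.

End deterministic_step.

(** * Joint measurability *)

Section caratheodory.
Context dT (T : measurableType dT) (R : realType).

Lemma bigcup_countType_measurable (K : countType) (A : K -> set T) :
  (forall k, measurable (A k)) -> measurable (\bigcup_k A k).
Proof.
move=> mA.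
have -> : \bigcup_k A k = \bigcup_n (if unpickle n is Some k then A k else set0).
  apply/seteqP; split=> t [n _].
    by move=> At; exists (pickle n) => //; rewrite pickleK.
  by case: (unpickle n) => // k At; exists k.
by apply: bigcupT_measurable => n; case: (unpickle n).
Qed.

(** A function that is measurable in one variable and continuous in the other
    one is measurable along measurable curves. *)
Lemma measurable_caratheodory d (phi : 'rV[R]_d -> T -> R) (u : T -> 'rV[R]_d) :
  (forall x, measurable_fun setT (phi x)) ->
  (forall t, continuous (phi ^~ t)) ->
  (forall i, measurable_fun setT (fun t => u t 0 i)) ->
  measurable_fun setT (fun t => phi (u t) t).
Proof.
move=> mphi cphi mu.
(* [u] is a limit of functions with values in a countable grid *)
pose fl n (t : T) (i : 'I_d) : int := Num.floor (n.+1%:R * u t 0 i).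
pose grid n (k : 'rV[int]_d) : 'rV[R]_d := \row_i ((k 0 i)%:~R / n.+1%:R).
pose un n t := grid n (\row_i fl n t i).
apply: (@measurable_fun_cvg _ _ _ _ (fun n t => phi (un n t) t)).
  move=> n _ B mB; rewrite setTI.
  have -> : (fun t => phi (un n t) t) @^-1` B = \bigcup_(k : 'rV[int]_d)
     ((\bigcap_(i in [set: 'I_d]) [set t | fl n t i = k 0 i]) `&`
      (phi (grid n k) @^-1` B)).
    apply/seteqP; split=> t /=.
      move=> Bt; exists (\row_i fl n t i) => //; split => //.
      by move=> i _ /=; rewrite mxE.
    move=> [k _ [fk]].
    suff -> : un n t = grid n k by [].
    by congr grid; apply/rowP => i; rewrite mxE; exact: fk.
  apply: bigcup_countType_measurable => k; apply: measurableI; last first.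
    by rewrite -[X in measurable X]setTI; exact: mphi.
  apply: fin_bigcap_measurable; first exact: finite_finset.
  move=> i _.
  have -> : [set t | fl n t i = k 0 i] = setT `&`
      (fun t => n.+1%:R * u t 0 i) @^-1` `[(k 0 i)%:~R, (k 0 i + 1)%:~R[%classic.
    rewrite setTI; apply/seteqP; split=> t /=; rewrite in_itv/=.
      by rewrite /fl => <-; exact: floor_itv.
    by move=> h; exact: floor_def.
  by apply: measurable_funM => //; exact: mu.
move=> t _; apply: (@continuous_cvg _ _ _ _ _ (fun n => un n t) (phi ^~ t)).
  exact: cphi.
move=> A [P Pn PA].
suff: \forall n \near \oo, forall ij : 'I_1 * 'I_d, P ij.1 ij.2 (un n t ij.1 ij.2).
  by apply: filterS => n Pun; apply: PA => i j; exact: (Pun (i, j)).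
apply: filter_forall => -[i j] /=; rewrite ord1.
suff : (fun n => un n t 0 j) @ \oo --> u t 0 j by apply; rewrite -(ord1 i).
apply/cvgrPdist_le => e e0.
near=> n; rewrite !mxE /fl.
have n0 : 0 < n.+1%:R :> R by [].
have /andP[h1 h2] := floor_itv (n.+1%:R * u t 0 j).
rewrite intrD1 in h2.
have -> : u t 0 j - (Num.floor (n.+1%:R * u t 0 j))%:~R / n.+1%:R =
    (n.+1%:R * u t 0 j - (Num.floor (n.+1%:R * u t 0 j))%:~R) / n.+1%:R.
  by rewrite mulrBl mulrAC divff ?mul1r// gt_eqF.
rewrite ger0_norm; last by rewrite divr_ge0// subr_ge0.
apply: (@le_trans _ _ (n.+1%:R^-1)).
  by rewrite ler_pdivrMr// mulVf ?gt_eqF// lerBlDl ltW// addrC.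
apply/ltW; near: n; exact: (near_infty_natSinv_lt (PosNum e0)).
Unshelve. all: end_near. Qed.

End caratheodory.

Section measurable_gradient.
Context dT (T : measurableType dT) (R : realType) (d : nat).

Lemma gradient_cvg (f : 'rV[R]_d -> R) x i : differentiable f x ->
  n.+1%:R * (f (n.+1%:R^-1 *: delta_mx 0 i + x) - f x) @[n --> \oo]
  --> gradient f x 0 i.
Proof.
move=> df; rewrite mxE.
have /cvg_ex[l hl] := @diff_derivable _ _ _ f x (delta_mx 0 i) df.
have -> : 'D_(delta_mx 0 i) f x = l by exact: cvg_lim hl.
have h0 : (fun n => n.+1%:R^-1 : R) @ \oo --> (0 : R)^'.
  move=> A [e /= e0 eA].
  suff : \forall n \near \oo, A (n.+1%:R^-1) by [].
  near=> n; apply: eA; last by rewrite /= invr_eq0 pnatr_eq0.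
  rewrite /= sub0r normrN ger0_norm ?invr_ge0//.
  near: n; exact: (near_infty_natSinv_lt (PosNum e0)).
have := cvg_comp _ _ h0 hl; apply: cvg_trans; apply: near_eq_cvg.
by near=> n; rewrite /= invrK.
Unshelve. all: end_near. Qed.

(** Gradients are limits of difference quotients, hence measurable along
    measurable curves. *)
Lemma measurable_gradient (phi : 'rV[R]_d -> T -> R) (u : T -> 'rV[R]_d) i :
  (forall x, measurable_fun setT (phi x)) ->
  (forall t x, differentiable (phi ^~ t) x) ->
  (forall j, measurable_fun setT (fun t => u t 0 j)) ->
  measurable_fun setT (fun t => gradient (phi ^~ t) (u t) 0 i).
Proof.
move=> mphi dphi mu.
have cphi t : continuous (phi ^~ t).
  by move=> x; exact: differentiable_continuous.
apply: (measurable_fun_cvg (h := fun n t => n.+1%:R *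
   (phi (n.+1%:R^-1 *: delta_mx 0 i + u t) t - phi (u t) t))).
  move=> n; apply: measurable_funM => //; apply: measurable_funB.
    apply: (measurable_caratheodory (u := fun t => _ + u t)) => // j.
    by under eq_fun do rewrite mxE; apply: measurable_funD.
  exact: measurable_caratheodory.
by move=> t _; exact: (@gradient_cvg (phi ^~ t)).
Qed.

End measurable_gradient.

(** * Integration over a draw that is independent of a sigma-algebra *)

Section fresh_draw.
Local Open Scope ereal_scope.
Context dO dZ (Omega : measurableType dO) (Z : measurableType dZ) (R : realType).
Variables (P : probability Omega R) (D : probability Z R).
Variables (G : set (set Omega)) (Y : {RV P >-> Z}).
Hypotheses (GT : G setT) (GI : setI_closed G) (Gm : G `<=` measurable).
Hypothesis GY : forall E B, G E -> measurable B ->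
  P (E `&` Y @^-1` B) = P E * D B.

(** Independence extends from the pi-system [G] to the sigma-algebra it
    generates. *)
Lemma fresh_draw_indep E B : <<s G >> E -> measurable B ->
  P (E `&` Y @^-1` B) = P E * D B.
Proof.
move=> GE mB.
have mY : measurable (Y @^-1` B).
  by rewrite -[X in measurable X]setTI; exact: measurable_funPT.
have DB0 : (0 <= fine (D B))%R by exact: fine_ge0.
rewrite -[LHS]/(mrestr P mY E) muleC.
rewrite -(fineK (fin_num_measure D _ mB)) -[RHS]/(mscale (NngNum DB0) P E).
apply: (@g_sigma_algebra_measure_unique _ _ _ G Gm (fun=> setT)) => //.
- by rewrite bigcup_const//; exists 0%N.
- move=> A GA.
  rewrite -[LHS]/(P (A `&` Y @^-1` B)) -[RHS]/((fine (D B))%:E * P A).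
  by rewrite fineK ?fin_num_measure// muleC GY.
- by move=> _; rewrite -ge0_fin_numE//; exact: fin_num_measure.
Qed.

(* [Omega] with the coarser sigma-algebra generated by [G] *)
Let past := g_sigma_algebraType G.

Lemma measurable_to_past : measurable_fun setT (id : Omega -> past).
Proof.
move=> _ A mA; rewrite setTI preimage_id.
by apply: (smallest_sub (@sigma_algebra_measurable _ Omega) Gm).
Qed.

Let to_past_mixin := isMeasurableFun.Build _ _ _ _ _ measurable_to_past.
Let to_past : {mfun Omega >-> past} := HB.pack (id : Omega -> past) to_past_mixin.

Let past_draw (w : Omega) : (past * Z)%type := (to_past w, Y w).

Lemma measurable_past_draw : measurable_fun setT past_draw.
Proof. by apply: measurable_fun_pair. Qed.

Let past_draw_mixin := isMeasurableFun.Build _ _ _ _ _ measurable_past_draw.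
Let past_draw_mfun : {mfun Omega >-> (past * Z)%type} := HB.pack past_draw past_draw_mixin.

(** The joint law of the past and the draw is a product measure. *)
Lemma past_draw_law A : measurable A ->
  (distribution P to_past \x D) A = distribution P past_draw_mfun A.
Proof.
apply: product_measure_unique => E B mE mB.
rewrite -[RHS]fresh_draw_indep//.
Qed.

Lemma fresh_draw_integral_eq0 (g : (past * Z)%type -> R) :
  measurable_fun setT g ->
  P.-integrable setT (fun w => (g (w, Y w))%:E) ->
  (forall w, \int[D]_z (g (w, z))%:E = 0) ->
  \int[P]_w (g (w, Y w))%:E = 0.
Proof.
move=> mg ig g0.
have mgE : measurable_fun setT (EFin \o g) by exact/measurable_EFinP.
rewrite -[LHS](@integral_distribution _ _ _ _ _ P past_draw_mfun (EFin \o g))//.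
rewrite (eq_measure_integral (distribution P to_past \x D)); last first.
  by move=> A mA _; exact/esym/past_draw_law.
rewrite -integral12_prod_meas1/=; last first.
  have /integrableP[_ gfin] : (distribution P past_draw_mfun).-integrable setT (EFin \o g).
    exact: integrable_pushforward.
  apply/integrableP; split => //; apply: le_lt_trans gfin.
  rewrite [leRHS](eq_measure_integral (distribution P to_past \x D)) => [//|A mA _].
  exact/esym/past_draw_law.
by apply: integral0_eq => w _; exact: g0.
Qed.

Lemma fresh_draw_integral_le (g : (past * Z)%type -> R) (c : R) :
  measurable_fun setT g -> (forall wz, 0 <= g wz)%R ->
  (forall w, \int[D]_z (g (w, z))%:E <= c%:E) ->
  \int[P]_w (g (w, Y w))%:E <= c%:E.
Proof.
move=> mg g0 gc.
have mgE : measurable_fun setT (EFin \o g) by exact/measurable_EFinP.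
rewrite -[leLHS](@ge0_integral_distribution _ _ _ _ _ P past_draw_mfun (EFin \o g))//.
rewrite (eq_measure_integral (distribution P to_past \x D)); last first.
  by move=> A mA _; exact/esym/past_draw_law.
rewrite fubini_tonelli1//=.
apply: (@le_trans _ _ (\int[distribution P to_past]_w c%:E)).
  apply: ge0_le_integral => //.
  - by move=> w _; apply: integral_ge0 => z _; rewrite lee_fin.
  - exact: (measurable_fun_fubini_tonelli_F (EFin \o g)).
  - by move=> w _; exact: gc.
by rewrite integral_cst//= /distribution /pushforward preimage_setT probability_setT mule1.
Qed.

End fresh_draw.

Section other_draws.
Local Open Scope ereal_scope.
Context dO dZ (Omega : measurableType dO) (Z : measurableType dZ) (R : realType).
Variables (P : probability Omega R) (D : probability Z R).
Variables (I : finType) (X : I -> {RV P >-> Z}) (i0 : I).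
Hypothesis X_indep : mutually_independent P (fun i w => X i w).
Hypothesis X_law : forall i A, measurable A -> P (X i @^-1` A) = D A.

(** The events on the draws other than [X i0] that are finite intersections of
    events on one draw; they generate the sigma-algebra of these draws. *)
Definition cylinders : set (set Omega) :=
  [set E | exists A : I -> set Z, (forall i, measurable (A i)) /\
     E = \bigcap_(i in [set i | i != i0]) (X i @^-1` A i)].

Lemma cylindersT : cylinders setT.
Proof.
exists (fun=> setT); split => //.
by apply/esym; rewrite -subTset => w _ i _.
Qed.

Lemma cylindersI : setI_closed cylinders.
Proof.
move=> _ _ [A [mA ->]] [B [mB ->]].
exists (fun i => A i `&` B i); split; first by move=> i; exact: measurableI.
by rewrite -bigcapI; apply: eq_bigcapr => i _; rewrite preimage_setI.
Qed.

Lemma measurable_draw i A : measurable A -> measurable (X i @^-1` A).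
Proof. by move=> mA; rewrite -[X in measurable X]setTI; exact: measurable_funPT. Qed.

Lemma cylinders_measurable : cylinders `<=` measurable.
Proof.
move=> _ [A [mA ->]]; apply: fin_bigcap_measurable; first exact: finite_finset.
by move=> i _; exact: measurable_draw.
Qed.

Lemma cylinders_indep E B : cylinders E -> measurable B ->
  P (E `&` X i0 @^-1` B) = P E * D B.
Proof.
move=> [A [mA ->]] mB.
pose A' i := if i == i0 then B else A i.
have mA' i : measurable (A' i) by rewrite /A'; case: ifP.
have -> : \bigcap_(i in [set i | i != i0]) (X i @^-1` A i) `&` X i0 @^-1` B =
    \bigcap_(i in [set` [set: I]%SET]) (X i @^-1` A' i).
  apply/seteqP; split=> w /=.
    move=> [h1 h2] i _; rewrite /A' /=; case: ifPn => [/eqP ->//|ii0].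
    exact: h1.
  move=> h; split; last by have := h i0; rewrite /A' eqxx; apply; rewrite /= inE.
  by move=> i /= ii0; have := h i; rewrite /A' (negPf ii0); apply; rewrite /= inE.
have -> : \bigcap_(i in [set i | i != i0]) (X i @^-1` A i) =
    \bigcap_(i in [set` [set~ i0]%SET]) (X i @^-1` A i).
  rewrite (_ : [set i | i != i0] = [set` [set~ i0]%SET])//.
  by apply/seteqP; split=> i /=; rewrite !inE.
rewrite (X_indep _ mA') (X_indep _ mA) (bigD1 i0) ?inE//= {1}/A' eqxx X_law//.
rewrite muleC; congr (_ * _); apply: eq_big => [i|i].
  by rewrite !inE.
by rewrite !inE /= => ii0; rewrite /A' (negPf ii0).
Qed.

Lemma measurable_other_draw i : i != i0 ->
  measurable_fun setT (X i : g_sigma_algebraType cylinders -> Z).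
Proof.
move=> ii0 _ B mB; rewrite setTI; apply: sub_sigma_algebra.
exists (fun j => if j == i then B else setT); split.
  by move=> j; case: ifP.
apply/seteqP; split => w /=.
  by move=> XB j _ /=; case: ifPn => // /eqP ->.
by move=> /(_ i ii0) /=; rewrite eqxx.
Qed.

End other_draws.

(** * Square-integrable random variables and vectors *)

Section square_integrable.
Context dO (Omega : measurableType dO) (R : realType) (P : probability Omega R).
Implicit Types (X Y : Omega -> R).

(** Integrability and expectation of real random variables. *)
Definition intble X := P.-integrable setT (EFin \o X).
Definition Ex X : R := \int[P]_w X w.
(** Square-integrable random variables. *)
Definition sqint X := measurable_fun setT X /\ intble (fun w => X w ^+ 2).

Lemma intble_le X Y : measurable_fun setT X -> intble Y ->
  (forall w, `|X w| <= Y w) -> intble X.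
Proof.
move=> mX iY XY; apply: le_integrable iY => //; first exact/measurable_EFinP.
by move=> w _; rewrite /= lee_fin; apply: le_trans (XY w) (ler_norm _).
Qed.

Lemma intbleD X Y : intble X -> intble Y -> intble (fun w => X w + Y w).
Proof. by move=> iX iY; exact: (integrableD measurableT iX iY). Qed.

Lemma intbleZ c X : intble X -> intble (fun w => c * X w).
Proof. by move=> iX; exact: (integrableZl measurableT c iX). Qed.

Lemma intble_cst c : intble (fun=> c).
Proof. exact: finite_measure_integrable_cst. Qed.

Lemma intble_sum (I : Type) (s : seq I) (F : I -> Omega -> R) :
  (forall i, intble (F i)) -> intble (fun w => \sum_(i <- s) F i w).
Proof.
move=> iF; elim: s => [|i s IH].
  by under eq_fun do rewrite big_nil; exact: intble_cst.
by under eq_fun do rewrite big_cons; exact: intbleD.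
Qed.

Lemma ExD X Y : intble X -> intble Y -> Ex (fun w => X w + Y w) = Ex X + Ex Y.
Proof. by move=> iX iY; exact: RintegralD. Qed.

Lemma ExZ c X : intble X -> Ex (fun w => c * X w) = c * Ex X.
Proof. by move=> iX; exact: RintegralZl. Qed.

Lemma ExZD c X Y : intble X -> intble Y ->
  Ex (fun w => c * X w + Y w) = c * Ex X + Ex Y.
Proof. by move=> iX iY; rewrite ExD ?ExZ//; exact: intbleZ. Qed.

Lemma intbleZD c X Y : intble X -> intble Y -> intble (fun w => c * X w + Y w).
Proof. by move=> iX iY; apply: intbleD => //; exact: intbleZ. Qed.

Lemma Ex_cst c : Ex (fun=> c) = c.
Proof. by rewrite /Ex Rintegral_cst//= probability_setT mulr1. Qed.

Lemma Ex_le X Y : intble X -> intble Y -> (forall w, X w <= Y w) -> Ex X <= Ex Y.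
Proof. by move=> iX iY XY; exact: le_Rintegral. Qed.

Lemma Ex_ge0 X : (forall w, 0 <= X w) -> 0 <= Ex X.
Proof. by move=> X0; exact: Rintegral_ge0. Qed.

Lemma Ex_sum (I : Type) (s : seq I) (F : I -> Omega -> R) :
  (forall i, intble (F i)) ->
  Ex (fun w => \sum_(i <- s) F i w) = \sum_(i <- s) Ex (F i).
Proof.
move=> iF; elim: s => [|i s IH].
  by rewrite big_nil; under [LHS]eq_Rintegral do rewrite big_nil; exact: Ex_cst.
rewrite big_cons -IH -ExD//; last exact: intble_sum.
by apply: eq_Rintegral => w _; rewrite big_cons.
Qed.

Lemma expectation_Ex X : intble X -> 'E_P[X]%E = (Ex X)%:E.
Proof. by move=> iX; rewrite unlock /Ex /Rintegral fineK//; exact: integrable_fin_num. Qed.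

Lemma Ex_integral X : intble X -> (\int[P]_w (X w)%:E)%E = (Ex X)%:E.
Proof. by move=> iX; rewrite -expectation_Ex// unlock. Qed.

Lemma sqint_intbleM X Y : sqint X -> sqint Y -> intble (fun w => X w * Y w).
Proof.
move=> [mX iX] [mY iY]; apply: (intble_le _ (intbleD iX iY)).
  exact: measurable_funM.
move=> w; rewrite ler_norml; apply/andP; split.
  by have := sqr_ge0 (X w + Y w); have := sqr_ge0 (X w);
     have := sqr_ge0 (Y w); rewrite sqrrD -mulr_natl; lra.
by have := sqr_ge0 (X w - Y w); have := sqr_ge0 (X w);
   have := sqr_ge0 (Y w); rewrite sqrrB -mulr_natl; lra.
Qed.

Lemma sqintD X Y : sqint X -> sqint Y -> sqint (fun w => X w + Y w).
Proof.
move=> sX sY; split; first by case: sX sY => mX _ [mY _]; exact: measurable_funD.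
under eq_fun do rewrite sqrrD -mulr_natl.
apply: intbleD; last by case: sY.
by apply: intbleD; [case: sX | exact/intbleZ/sqint_intbleM].
Qed.

Lemma sqintZ c X : sqint X -> sqint (fun w => c * X w).
Proof.
move=> [mX iX]; split; first exact: measurable_funM.
by under eq_fun do rewrite exprMn; exact: intbleZ.
Qed.

Lemma sqint_cst c : sqint (fun=> c).
Proof. by split => //; exact: intble_cst. Qed.

Variable d : nat.
Implicit Types u v : Omega -> 'rV[R]_d.

(** Random vectors with square-integrable coordinates. *)
Definition vsqint u := forall i, sqint (fun w => u w 0 i).

Lemma vsqintD u v : vsqint u -> vsqint v -> vsqint (fun w => u w + v w).
Proof. by move=> su sv i; under eq_fun do rewrite mxE; exact: sqintD. Qed.

Lemma vsqintZ c u : vsqint u -> vsqint (fun w => c *: u w).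
Proof. by move=> su i; under eq_fun do rewrite mxE; exact: sqintZ. Qed.

Lemma vsqintB u v : vsqint u -> vsqint v -> vsqint (fun w => u w - v w).
Proof.
move=> su sv; under eq_fun do rewrite -scaleN1r.
by apply: vsqintD => //; exact: vsqintZ.
Qed.

Lemma vsqint_cst c : vsqint (fun=> c).
Proof. by move=> i; exact: sqint_cst. Qed.

Lemma vsqint_sum (J : Type) (s : seq J) (F : J -> Omega -> 'rV[R]_d) :
  (forall j, vsqint (F j)) -> vsqint (fun w => \sum_(j <- s) F j w).
Proof.
move=> sF; elim: s => [|j s IH].
  by under eq_fun do rewrite big_nil; exact: vsqint_cst.
by under eq_fun do rewrite big_cons; exact: vsqintD.
Qed.

Lemma vsqint_vmean M (F : 'I_M -> Omega -> 'rV[R]_d) :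
  (forall m, vsqint (F m)) -> vsqint (fun w => vmean (F^~ w)).
Proof. by move=> sF; apply: vsqintZ; exact: vsqint_sum. Qed.

Lemma intble_inner u v : vsqint u -> vsqint v -> intble (fun w => inner (u w) (v w)).
Proof.
move=> su sv; under eq_fun do rewrite innerE.
by apply: intble_sum => i; exact: sqint_intbleM.
Qed.

Lemma intble_smean M (F : 'I_M -> Omega -> R) :
  (forall m, intble (F m)) -> intble (fun w => smean (F^~ w)).
Proof. by move=> iF; apply: intbleZ; exact: intble_sum. Qed.

Lemma Ex_smean M (F : 'I_M -> Omega -> R) :
  (forall m, intble (F m)) -> Ex (fun w => smean (F^~ w)) = smean (fun m => Ex (F m)).
Proof. by move=> iF; rewrite ExZ ?Ex_sum//; exact: intble_sum. Qed.

Lemma vsqint_le u (Y : Omega -> R) :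
  (forall i, measurable_fun setT (fun w => u w 0 i)) -> intble Y ->
  (forall w, inner (u w) (u w) <= Y w) -> vsqint u.
Proof.
move=> mu iY uY i; split => //; apply: intble_le iY _.
  exact: measurable_funX.
move=> w; rewrite ger0_norm ?sqr_ge0//; apply: le_trans (uY w).
rewrite innerE (bigD1 i)//= -expr2 lerDl.
by apply: sumr_ge0 => j _; rewrite -expr2 sqr_ge0.
Qed.

End square_integrable.

(** * The noise of the stochastic gradients *)

Lemma coordB (R : realType) d (u v : 'rV[R]_d) i : (u - v) 0 i = u 0 i - v 0 i.
Proof. by rewrite mxE [X in _ + X]mxE. Qed.

Lemma coordZ (R : realType) d a (u : 'rV[R]_d) i : (a *: u) 0 i = a * u 0 i.
Proof. by rewrite mxE. Qed.

Section vector_measurability.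
Context (R : realType) (d : nat) dT (T : measurableType dT).
Implicit Types u v : T -> 'rV[R]_d.

(** Coordinatewise measurability of a random vector. *)
Definition vmeasurable u := forall i, measurable_fun setT (fun w => u w 0 i).

Lemma vmeasurableB u v :
  vmeasurable u -> vmeasurable v -> vmeasurable (fun w => u w - v w).
Proof.
by move=> mu mv i; under eq_fun do rewrite coordB; exact: measurable_funB.
Qed.

Lemma vmeasurableZ c u : vmeasurable u -> vmeasurable (fun w => c *: u w).
Proof.
by move=> mu i; under eq_fun do rewrite coordZ; exact: measurable_funM.
Qed.

Lemma vmeasurable_vmean M (u : 'I_M -> T -> 'rV[R]_d) :
  (forall m, vmeasurable (u m)) -> vmeasurable (fun w => vmean (u ^~ w)).
Proof.
move=> mu i; under eq_fun do rewrite coordZ summxE.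
by apply: measurable_funM => //; apply: measurable_sum => m; exact: mu.
Qed.

Lemma vmeasurable_cst c : vmeasurable (fun=> c).
Proof. by move=> i; exact: measurable_cst. Qed.

End vector_measurability.

Section local_sgd_measurable.
Context (R : realType) (d M H : nat) dZ (Z : measurableType dZ).
Variables (f : 'rV[R]_d -> Z -> R) (F : 'rV[R]_d -> R).
Variables (gamma : nat -> R) (x0 : 'rV[R]_d).
Hypothesis f_meas : forall x, measurable_fun setT (f x).
Hypothesis f_diff : forall x z, differentiable (f^~ z) x.
Hypothesis F_diff : forall x, differentiable F x.

(** The iterates, and the difference between the stochastic gradient and the
    gradient used at step [t] on device [m], as functions of the draws. *)
Definition iterate (z : nat -> 'I_M -> Z) t m : 'rV[R]_d :=
  local_sgd (stoch_grad f) H gamma x0 z t m.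

Definition noise (z : nat -> 'I_M -> Z) t m : 'rV[R]_d :=
  stoch_grad f (iterate z t m) (z t m) - gradient F (iterate z t m).

Context dT (T : measurableType dT).
Variable zt : nat -> 'I_M -> T -> Z.

Lemma measurable_stoch_grad (u : T -> 'rV[R]_d) (v : T -> Z) :
  vmeasurable u -> measurable_fun setT v ->
  vmeasurable (fun w => stoch_grad f (u w) (v w)).
Proof.
move=> mu mv i.
apply: (@measurable_gradient _ _ _ _ (fun y w => f y (v w))) => //.
by move=> x; exact: measurableT_comp.
Qed.

Lemma measurable_grad (u : T -> 'rV[R]_d) :
  vmeasurable u -> vmeasurable (fun w => gradient F (u w)).
Proof.
by move=> mu i; exact: (@measurable_gradient _ _ _ _ (fun y _ => F y)).
Qed.

Lemma measurable_iterate t :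
  (forall s m, (s < t)%N -> measurable_fun setT (zt s m)) ->
  forall m, vmeasurable (fun w => iterate (fun s j => zt s j w) t m).
Proof.
elim: t => [|t IH] mz m; first exact: vmeasurable_cst.
have {}IH := IH (fun s m st => mz s m (ltn_trans st (ltnSn t))).
have my j : vmeasurable (fun w => iterate (fun s j => zt s j w) t j
    - gamma t *: stoch_grad f (iterate (fun s j => zt s j w) t j) (zt t j w)).
  apply: vmeasurableB; first exact: IH.
  by apply: vmeasurableZ; apply: measurable_stoch_grad => //; exact: mz.
rewrite /iterate /=; case: (H %| t.+1)%N; last exact: my.
exact: vmeasurable_vmean my.
Qed.

Lemma measurable_noise t m :
  (forall s j, (s < t)%N -> measurable_fun setT (zt s j)) ->
  measurable_fun setT (zt t m) ->
  vmeasurable (fun w => noise (fun s j => zt s j w) t m).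
Proof.
move=> mz mt; have mx := measurable_iterate mz.
by apply: vmeasurableB; [exact: measurable_stoch_grad | exact: measurable_grad].
Qed.

End local_sgd_measurable.

Section noise_moments.
Context (R : realType) (d M H T : nat) (dZ dO : measure_display).
Context (Z : measurableType dZ) (Omega : measurableType dO).
Variables (D : probability Z R) (P : probability Omega R).
Variables (f : 'rV[R]_d -> Z -> R) (F : 'rV[R]_d -> R) (sigma : R).
Variables (gamma : nat -> R) (x0 : 'rV[R]_d) (zeta : nat -> 'I_M -> {RV P >-> Z}).
Hypothesis f_meas : forall x, measurable_fun setT (f x).
Hypothesis f_diff : forall x z, differentiable (f^~ z) x.
Hypothesis F_diff : forall x, differentiable F x.
Hypothesis oracle_mean : forall x i,
  D.-integrable setT (EFin \o (fun z => stoch_grad f x z 0 i)) /\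
  (\int[D]_z (stoch_grad f x z 0 i)%:E = (gradient F x 0 i)%:E)%E.
Hypothesis oracle_variance : forall x,
  (\int[D]_z (inner (stoch_grad f x z - gradient F x)
                    (stoch_grad f x z - gradient F x))%:E <= (sigma ^+ 2)%:E)%E.
Hypothesis zeta_iid : iid_draws D T zeta.

Let X t m w := iterate H f gamma x0 (fun s j => zeta s j w) t m.
Let N t m w := noise H f F gamma x0 (fun s j => zeta s j w) t m.
Let draw (i : 'I_T * 'I_M) : {RV P >-> Z} := zeta i.1 i.2.
(* [Omega] with the sigma-algebra of all draws but [draw i] *)
Let past i := g_sigma_algebraType (cylinders draw i).

Let law i A : measurable A -> P (draw i @^-1` A) = D A.
Proof. by move=> mA; case: zeta_iid => /(_ i.1 i.2 (ltn_ord _) A mA). Qed.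

Let indep : mutually_independent P (fun i w => draw i w).
Proof. by case: zeta_iid. Qed.

Let zetaT s j : measurable_fun setT (zeta s j).
Proof. exact: measurable_funPT. Qed.

Let measurable_past_draw t (tT : (t < T)%N) m s j : (s < T)%N -> (s, j) != (t, m) ->
  measurable_fun setT (zeta s j : past (Ordinal tT, m) -> Z).
Proof.
move=> sT sj; apply: (@measurable_other_draw _ _ _ _ _ _ _ draw _ (Ordinal sT, j)).
by apply: contra_neq sj => -[-> ->].
Qed.

(** The iterates of step [t] and the noises of the other devices do not depend
    on the draw of device [m] at step [t]. *)
Lemma iterate_past t (tT : (t < T)%N) m j :
  vmeasurable (X t j : past (Ordinal tT, m) -> 'rV[R]_d).
Proof.
apply: (measurable_iterate H gamma x0 f_meas f_diff
  (zt := fun s l (w : past (Ordinal tT, m)) => zeta s l w)) => // s l st.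
apply: measurable_past_draw; first exact: ltn_trans tT.
by apply: contraTneq st => -[-> _]; rewrite ltnn.
Qed.

Lemma noise_past t (tT : (t < T)%N) m j : j != m ->
  vmeasurable (N t j : past (Ordinal tT, m) -> 'rV[R]_d).
Proof.
move=> jm.
apply: (measurable_noise H gamma x0 f_meas f_diff F_diff
  (zt := fun s l (w : past (Ordinal tT, m)) => zeta s l w)) => //.
  move=> s l st; apply: measurable_past_draw; first exact: ltn_trans tT.
  by apply: contraTneq st => -[-> _]; rewrite ltnn.
by apply: measurable_past_draw => //; apply: contra_neq jm => -[].
Qed.

Lemma measurable_N t m : vmeasurable (N t m).
Proof. exact: measurable_noise. Qed.

(* the noise, as a function of the other draws and of the draw *)
Let g_noise t (tT : (t < T)%N) m (wz : (past (Ordinal tT, m) * Z)%type) : 'rV[R]_d :=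
  stoch_grad f (X t m wz.1) wz.2 - gradient F (X t m wz.1).

Let measurable_g_noise t (tT : (t < T)%N) m : vmeasurable (@g_noise t tT m).
Proof.
have mX : vmeasurable (fun wz : (past (Ordinal tT, m) * Z)%type => X t m wz.1).
  by move=> k; exact: (measurableT_comp (@iterate_past t tT m m k) measurable_fst).
by apply: vmeasurableB; [exact: measurable_stoch_grad | exact: measurable_grad].
Qed.

Let noise_int t m : (t < T)%N ->
  (\int[P]_w (inner (N t m w) (N t m w))%:E <= (sigma ^+ 2)%:E)%E.
Proof.
move=> tT; apply: (@fresh_draw_integral_le _ _ _ _ _ P D
  (cylinders draw (Ordinal tT, m)) (zeta t m) _ _ _ _
  (fun wz => inner (g_noise wz) (g_noise wz))).
- exact: cylindersT.
- exact: cylindersI.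
- exact: cylinders_measurable.
- by move=> E B cE mB; exact: (cylinders_indep indep law cE mB).
- under eq_fun do rewrite innerE.
  by apply: measurable_sum => k; apply: measurable_funM; exact: measurable_g_noise.
- by move=> wz; exact: inner_ge0.
- by move=> w; exact: (oracle_variance (X t m w)).
Qed.

Lemma intble_noise_sqr t m : (t < T)%N ->
  intble P (fun w => inner (N t m w) (N t m w)).
Proof.
move=> tT; apply/integrableP; split.
  apply/measurable_EFinP; under eq_fun do rewrite innerE.
  by apply: measurable_sum => k; apply: measurable_funM; exact: measurable_N.
apply: (@le_lt_trans _ _ (sigma ^+ 2)%:E); last exact: ltry.
apply: le_trans (noise_int m tT); rewrite le_eqVlt; apply/orP; left; apply/eqP.
by apply: eq_integral => w _; rewrite /= ger0_norm// inner_ge0.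
Qed.

Lemma Ex_noise_sqr t m : (t < T)%N ->
  Ex P (fun w => inner (N t m w) (N t m w)) <= sigma ^+ 2.
Proof.
move=> tT; rewrite -lee_fin -Ex_integral; last exact: intble_noise_sqr.
exact: noise_int.
Qed.

Lemma vsqint_noise t m : (t < T)%N -> vsqint P (N t m).
Proof.
move=> tT; apply: vsqint_le (intble_noise_sqr m tT) _ => //.
exact: measurable_N.
Qed.

Lemma Ex_noise_coord t (tT : (t < T)%N) m k (U : Omega -> R) :
  measurable_fun setT (U : past (Ordinal tT, m) -> R) -> sqint P U ->
  Ex P (fun w => N t m w 0 k * U w) = 0.
Proof.
move=> mU sU.
have iNU := sqint_intbleM (vsqint_noise m tT k) sU.
apply/EFin_inj; rewrite -Ex_integral//.
apply: (@fresh_draw_integral_eq0 _ _ _ _ _ P D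
  (cylinders draw (Ordinal tT, m)) (zeta t m) _ _ _ _
  (fun wz => g_noise wz 0 k * U wz.1)) => //.
- exact: cylindersT.
- exact: cylindersI.
- exact: cylinders_measurable.
- by move=> E B cE mB; exact: (cylinders_indep indep law cE mB).
- apply: measurable_funM; first exact: measurable_g_noise.
  exact: (measurableT_comp mU measurable_fst).
move=> w; rewrite /g_noise /=.
have [iG EG] := oracle_mean (X t m w) k.
under eq_integral do rewrite coordB EFinM EFinB.
have iC := finite_measure_integrable_cst D (gradient F (X t m w) 0 k) measurableT.
rewrite integralZr//; last exact: (integrableB measurableT iG iC).
rewrite (integralB measurableT iG iC).
set c := gradient F (X t m w) 0 k in EG iC *.
have -> : (\int[D]_z (EFin \o cst c) z = c%:E)%E.
  by rewrite (integral_cst D measurableT c%:E)/= probability_setT mule1.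
by rewrite [X in (X - _)%E]EG subee// mul0e.
Qed.

(** The noise is orthogonal to every random vector that does not depend on the
    draw. *)
Lemma Ex_noise_inner t (tT : (t < T)%N) m (U : Omega -> 'rV[R]_d) :
  vmeasurable (U : past (Ordinal tT, m) -> 'rV[R]_d) ->
  vsqint P U -> Ex P (fun w => inner (N t m w) (U w)) = 0.
Proof.
move=> mU sU; under [LHS]eq_Rintegral do rewrite innerE.
rewrite -/(Ex P _) Ex_sum; last first.
  by move=> k; apply: sqint_intbleM => //; exact: vsqint_noise.
by rewrite big1// => k _; exact: Ex_noise_coord (mU k) (sU k).
Qed.

(** Averaging over [M] devices divides the variance by [M], since the noises of
    different devices are orthogonal. *)
Lemma Ex_mean_noise_sqr t : (0 < M)%N -> (t < T)%N ->
  Ex P (fun w => inner (vmean (N t ^~ w)) (vmean (N t ^~ w))) <= sigma ^+ 2 / M%:R.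
Proof.
move=> M0 tT.
have iNN m j : intble P (fun w => inner (N t m w) (N t j w)).
  by apply: intble_inner; exact: vsqint_noise.
have iNv m : intble P (fun w => inner (N t m w) (vmean (N t ^~ w))).
  apply: intble_inner; first exact: vsqint_noise.
  by apply: vsqint_vmean => j; exact: vsqint_noise.
under [leLHS]eq_Rintegral do rewrite inner_vmeanl.
rewrite -/(Ex P _) (Ex_smean iNv) -[leRHS](smean_cst M0); apply: smean_le => m.
under [leLHS]eq_Rintegral do rewrite innerC inner_vmeanl.
rewrite -/(Ex P _) (Ex_smean (fun j => iNN j m)) mulrC ler_wpM2l ?invr_ge0//.
rewrite (bigD1 m)//= big1 ?addr0; first exact: Ex_noise_sqr.
move=> j jm; apply: (@Ex_noise_inner _ tT) => [k|]; last exact: vsqint_noise.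
by apply: noise_past; rewrite eq_sym.
Qed.

End noise_moments.

(** * The recursions in expectation *)

Section expected_recursion.
Context (R : realType) (d M H T : nat) (dZ dO : measure_display).
Context (Z : measurableType dZ) (Omega : measurableType dO).
Variables (D : probability Z R) (P : probability Omega R).
Variables (f : 'rV[R]_d -> Z -> R) (F Q S : 'rV[R]_d -> R).
Variables (muQ muS LS L sigma : R) (xstar : 'rV[R]_d).
Variables (gamma : nat -> R) (x0 : 'rV[R]_d) (zeta : nat -> 'I_M -> {RV P >-> Z}).
Hypothesis M_gt0 : (0 < M)%N.
Hypothesis f_meas : forall x, measurable_fun setT (f x).
Hypothesis f_diff : forall x z, differentiable (f^~ z) x.
Hypothesis F_diff : forall x, differentiable F x.
Hypothesis oracle_mean : forall x i,
  D.-integrable setT (EFin \o (fun z => stoch_grad f x z 0 i)) /\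
  (\int[D]_z (stoch_grad f x z 0 i)%:E = (gradient F x 0 i)%:E)%E.
Hypothesis oracle_variance : forall x,
  (\int[D]_z (inner (stoch_grad f x z - gradient F x)
                    (stoch_grad f x z - gradient F x))%:E <= (sigma ^+ 2)%:E)%E.
Hypothesis zeta_iid : iid_draws D T zeta.
Hypothesis FE : forall x, F x = Q x + S x.
Hypothesis gradFE : forall x, gradient F x = gradient Q x + gradient S x.
Hypothesis Q_quadratic : quadratic Q.
Hypotheses (muQ_ge0 : 0 <= muQ) (muS_ge0 : 0 <= muS) (L_gt0 : 0 < L).
Hypothesis Q_convex : forall x y, muQ / 2 * inner (x - y) (x - y) <= breg Q x y.
Hypothesis S_convex : forall x y, muS / 2 * inner (x - y) (x - y) <= breg S x y.
Hypothesis S_smooth : forall x y, breg S x y <= LS / 2 * inner (x - y) (x - y).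
Hypothesis F_smooth : forall x y, breg F x y <= L / 2 * inner (x - y) (x - y).
Hypothesis F_min : forall x, F xstar <= F x.
Hypothesis gamma_ge0 : forall t, 0 <= gamma t.
Hypothesis gammaL : forall t, 6 * (gamma t * L) <= 1.

(* [X t m] is the iterate of device [m], [N t m] its noise, [Xb t] the mean
   iterate, and [y t w m] the noiseless local step *)
Let mu := muQ + muS.
Let X t m w := iterate H f gamma x0 (fun s j => zeta s j w) t m.
Let N t m w := noise H f F gamma x0 (fun s j => zeta s j w) t m.
Let Xb t w := vmean (X t ^~ w).
Let y t w m := X t m w - gamma t *: gradient F (X t m w).
Let disp (v : 'I_M -> 'rV[R]_d) :=
  smean (fun m => inner (v m - vmean v) (v m - vmean v)).

Let F_sc x z : mu / 2 * inner (x - z) (x - z) <= breg F x z.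
Proof. exact: (F_strongly_convex FE gradFE Q_convex S_convex). Qed.

Let F_convex x z : 0 <= breg F x z.
Proof.
by apply: le_trans (F_sc x z); rewrite mulr_ge0 ?inner_ge0// divr_ge0// addr_ge0.
Qed.

(** Gradients of [F] grow at most linearly, hence preserve square
    integrability. *)
Lemma vsqint_grad (u : Omega -> 'rV[R]_d) :
  vsqint P u -> vsqint P (fun w => gradient F (u w)).
Proof.
move=> su.
set c := inner (gradient F xstar) (gradient F xstar).
apply: (@vsqint_le _ _ _ _ _ _ (fun w =>
    2 * (L * L) * inner (u w - xstar) (u w - xstar) + 2 * c)).
- move=> i; apply: measurable_grad => // j.
  by have [] := su j.
- apply: intbleD; last exact: intble_cst.
  have sb : vsqint P (fun w => u w - xstar) by apply: vsqintB su (vsqint_cst _ _).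
  by apply: intbleZ; exact: intble_inner.
move=> w; set a := gradient F (u w); set b := gradient F xstar.
have h1 := breg_cocoercive L_gt0 F_convex F_smooth (u w) xstar.
have h2 := ler_wpM2l (ltW L_gt0) (F_smooth (u w) xstar).
have h3 := inner_ge0 (a - b - b).
have h4 : inner (a - b - b) (a - b - b) =
    2 * inner (a - b) (a - b) + 2 * inner b b - inner a a.
  by rewrite (inner_sqrB (a - b)) (inner_sqrB a) (innerDl a (- b) b) innerNl; ring.
rewrite -/a -/b in h1; rewrite h4 in h3; rewrite -/b in c *; rewrite /c; lra.
Qed.

(** One step of the algorithm, with the noise split off. *)
Lemma iterateS t w : iterate H f gamma x0 (fun s j => zeta s j w) t.+1 =
  let v m := y t w m - gamma t *: N t m w in
  if (H %| t.+1)%N then fun=> vmean v else v.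
Proof.
have E m : X t m w - gamma t *: stoch_grad f (X t m w) (zeta t m w) =
    y t w m - gamma t *: N t m w.
  by rewrite /y /N /noise -/(X t m w) scalerBr opprB addrA subrK.
rewrite {1}/iterate /=; case: ifP => _.
  by apply/funext => m; rewrite /vmean; congr (_ *: _); apply: eq_bigr => j _; exact: E.
by apply/funext => m; exact: E.
Qed.

Lemma vsqint_iterate t m : (t <= T)%N -> vsqint P (X t m).
Proof.
elim: t m => [|t IH] m tT; first exact: vsqint_cst.
have sv j : vsqint P (fun w => y t w j - gamma t *: N t j w).
  apply: vsqintB.
    apply: vsqintB; first exact: IH (ltnW tT).
    by apply: vsqintZ; apply: vsqint_grad; exact: IH (ltnW tT).
  by apply: vsqintZ; exact: (vsqint_noise H gamma x0 f_meas f_diff F_diff oracle_variance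
    zeta_iid).
move=> i; rewrite /X; under eq_fun do rewrite iterateS/=.
case: (H %| t.+1)%N; last exact: sv.
exact: (vsqint_vmean sv).
Qed.

Lemma vsqint_mean t : (t <= T)%N -> vsqint P (Xb t).
Proof. by move=> tT; apply: vsqint_vmean => m; exact: vsqint_iterate. Qed.

(** Communication does not change the mean of the iterates. *)
Lemma meanS t w : Xb t.+1 w = vmean (y t w) - gamma t *: vmean (N t ^~ w).
Proof.
rewrite -vmeanZ -vmeanB /Xb /X iterateS /=; case: ifP => // _.
exact: vmean_cst.
Qed.

(** Expected squared distance of the mean iterate to [xstar], expected
    suboptimality of the mean iterate, and expected dispersion. *)
Definition mean_sqr_dist t := Ex P (fun w => inner (Xb t w - xstar) (Xb t w - xstar)).
Definition mean_gap t := Ex P (fun w => F (Xb t w) - F xstar).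
Definition mean_disp t := Ex P (fun w => disp (X t ^~ w)).

Lemma intble_gap t : (t <= T)%N -> intble P (fun w => F (Xb t w) - F xstar).
Proof.
move=> tT; have sX := vsqint_mean tT.
have sb : vsqint P (fun w => Xb t w - xstar) by apply: vsqintB sX (vsqint_cst _ _).
set b := gradient F xstar.
have iY : intble P (fun w => (L / 2) * inner (Xb t w - xstar) (Xb t w - xstar)
    + inner (Xb t w - xstar) b).
  apply: intbleD; first by apply: intbleZ; exact: intble_inner.
  by apply: intble_inner => //; exact: vsqint_cst.
apply: intble_le iY _.
  apply: measurable_funB => //.
  apply: (measurable_caratheodory (phi := fun y _ => F y)) => //.
    by move=> w x; exact: differentiable_continuous.
  by move=> i; have [] := sX i.
move=> w; rewrite ger0_norm ?subr_ge0//.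
have := F_smooth xstar (Xb t w).
by rewrite /breg -/b (innerC b) (inner_sqr_swap xstar); lra.
Qed.

Lemma intble_sqr_dist t : (t <= T)%N ->
  intble P (fun w => inner (Xb t w - xstar) (Xb t w - xstar)).
Proof.
move=> tT.
have sb : vsqint P (fun w => Xb t w - xstar).
  exact: vsqintB (vsqint_mean tT) (vsqint_cst _ _).
exact: intble_inner.
Qed.

Lemma intble_disp t : (t <= T)%N -> intble P (fun w => disp (X t ^~ w)).
Proof.
move=> tT; apply: (@intble_smean _ _ _ _ _ (fun m w => _)) => m.
have sb : vsqint P (fun w => X t m w - Xb t w).
  by apply: vsqintB; [exact: vsqint_iterate | exact: vsqint_mean].
exact: intble_inner.
Qed.

Lemma mean_sqr_dist0 : mean_sqr_dist 0 = inner (x0 - xstar) (x0 - xstar).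
Proof.
by rewrite /mean_sqr_dist /Xb /X /iterate /= vmean_cst// Ex_cst.
Qed.

Lemma mean_disp0 : mean_disp 0 = 0.
Proof.
rewrite /mean_disp -[RHS](Ex_cst P); congr Ex; apply/funext => w.
rewrite /disp /X /iterate /= vmean_cst// subrr; under eq_smean do rewrite inner0l.
exact: smean_cst.
Qed.

Lemma mean_disp_sync t : (H %| t.+1)%N -> mean_disp t.+1 = 0.
Proof.
move=> Ht; rewrite /mean_disp -[RHS](Ex_cst P); congr Ex; apply/funext => w.
rewrite /disp /X iterateS /= Ht vmean_cst// subrr; under eq_smean do rewrite inner0l.
exact: smean_cst.
Qed.

Lemma mean_gap_ge0 t : 0 <= mean_gap t.
Proof. by apply: Ex_ge0 => w; rewrite subr_ge0. Qed.

Let vsqint_y t m : (t < T)%N -> vsqint P (fun w => y t w m).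
Proof.
move=> tT; have sX := vsqint_iterate m (ltnW tT).
apply: vsqintB => //.
by apply: vsqintZ; apply: vsqint_grad.
Qed.

Let vsqint_N t m : (t < T)%N -> vsqint P (N t m).
Proof. exact: (vsqint_noise H gamma x0 f_meas f_diff F_diff oracle_variance
    zeta_iid). Qed.

(* [pastm tT m U] says that [U] is measurable for the sigma-algebra of all draws
   but that of device [m] at step [t] *)
Let past t (tT : (t < T)%N) m := g_sigma_algebraType
  (cylinders (fun i : 'I_T * 'I_M => zeta i.1 i.2) (Ordinal tT, m)).
Let pastm t (tT : (t < T)%N) m (U : Omega -> 'rV[R]_d) :=
  vmeasurable (U : past tT m -> 'rV[R]_d).

Let pastm_y t (tT : (t < T)%N) m j : pastm tT m (fun w => y t w j).
Proof.
have mX : pastm tT m (X t j) by exact: iterate_past.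
rewrite /pastm /y; apply: vmeasurableB; first exact: mX.
by apply: vmeasurableZ; exact: measurable_grad.
Qed.

Let pastm_ymean t (tT : (t < T)%N) m : pastm tT m (fun w => vmean (y t w)).
Proof.
apply: (vmeasurable_vmean (u := fun j (w : past tT m) => y t w j)) => j.
exact: pastm_y.
Qed.

Let Ex_noise t (tT : (t < T)%N) m U : pastm tT m U -> vsqint P U ->
  Ex P (fun w => inner (N t m w) (U w)) = 0.
Proof.
move=> mU sU.
exact: (Ex_noise_inner H gamma x0 f_meas f_diff F_diff oracle_mean oracle_variance
  zeta_iid mU sU).
Qed.

(** The expected squared distance to the minimizer along one step. *)
Lemma mean_sqr_dist_step t : (t < T)%N ->
  mean_sqr_dist t.+1 <= (1 - gamma t * mu) * mean_sqr_dist t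
    - 4 / 3 * gamma t * mean_gap t + 4 / 3 * gamma t * (LS * mean_disp t)
    + gamma t ^+ 2 * (sigma ^+ 2 / M%:R).
Proof.
move=> tT; have tT' := ltnW tT.
pose A w := vmean (y t w) - xstar.
pose Nb w := vmean (N t ^~ w).
have sA : vsqint P A.
  apply: vsqintB; last exact: vsqint_cst.
  by apply: (vsqint_vmean (F := fun m w => y t w m)) => m; exact: vsqint_y.
have sN m : vsqint P (N t m) by exact: vsqint_N.
have sNb : vsqint P Nb by exact: vsqint_vmean.
have ANb0 : Ex P (fun w => inner (Nb w) (A w)) = 0.
  rewrite /Nb; under [LHS]eq_Rintegral do rewrite inner_vmeanl.
  rewrite -/(Ex P _) (Ex_smean (F := fun m w => inner (N t m w) (A w))); last first.
    by move=> m; exact: intble_inner.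
  rewrite -[RHS](smean_cst M_gt0); apply: eq_smean => m.
  apply: (Ex_noise (tT := tT)) => //; apply: vmeasurableB; last exact: vmeasurable_cst.
  exact: pastm_ymean.
pose B w := (1 - gamma t * mu) * inner (Xb t w - xstar) (Xb t w - xstar)
     + (- (4 / 3 * gamma t) * (F (Xb t w) - F xstar)
     + (4 / 3 * gamma t * LS * disp (X t ^~ w)
     + (- (2 * gamma t) * inner (Nb w) (A w)
     + gamma t ^+ 2 * inner (Nb w) (Nb w)))).
have i1 := intble_sqr_dist tT'; have i2 := intble_gap tT'; have i3 := intble_disp tT'.
have i4 := intble_inner sNb sA; have i5 := intble_inner sNb sNb.
have j5 := intbleZ (gamma t ^+ 2) i5.
have j4 := intbleZD (- (2 * gamma t)) i4 j5.
have j3 := intbleZD (4 / 3 * gamma t * LS) i3 j4.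
have j2 := intbleZD (- (4 / 3 * gamma t)) i2 j3.
have iB : intble P B := intbleZD (1 - gamma t * mu) i1 j2.
have EB : Ex P B = (1 - gamma t * mu) * mean_sqr_dist t
    - 4 / 3 * gamma t * mean_gap t + 4 / 3 * gamma t * (LS * mean_disp t)
    + gamma t ^+ 2 * Ex P (fun w => inner (Nb w) (Nb w)).
  rewrite /B (ExZD _ i1 j2) (ExZD _ i2 j3) (ExZD _ i3 j4) (ExZD _ i4 j5) (ExZ _ i5).
  rewrite ANb0 /mean_sqr_dist /mean_gap /mean_disp; ring.
apply: (@le_trans _ _ (Ex P B)).
  apply: Ex_le => // [|w]; first exact: intble_sqr_dist.
  rewrite meanS -/(Nb w).
  have -> : vmean (y t w) - gamma t *: Nb w - xstar = A w - gamma t *: Nb w.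
    by rewrite addrAC.
  rewrite (inner_sqr_step (A w)).
  have AE : A w = Xb t w - gamma t *: vmean (fun m => gradient F (X t m w)) - xstar.
    by rewrite /A /y vmeanB vmeanZ.
  have := mean_gradient_step M_gt0 FE gradFE Q_quadratic muQ_ge0 muS_ge0 L_gt0
    Q_convex S_convex S_smooth F_smooth F_min (gamma_ge0 t) (gammaL t) (X t ^~ w).
  by rewrite -/(Xb t w) -AE -/(disp (X t ^~ w)) /B -/mu; lra.
rewrite EB lerD2l ler_wpM2l ?sqr_ge0//.
exact: (Ex_mean_noise_sqr H gamma x0 f_meas f_diff F_diff oracle_mean
  oracle_variance zeta_iid).
Qed.

(** The expected dispersion along one step without communication. *)
Lemma mean_disp_step t : (t < T)%N -> ~~ (H %| t.+1)%N ->
  mean_disp t.+1 <= (1 - gamma t * mu) * mean_disp t + gamma t ^+ 2 * sigma ^+ 2.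
Proof.
move=> tT Ht; have tT' := ltnW tT.
have sN m : vsqint P (N t m) by exact: vsqint_N.
pose U m w := y t w m - vmean (y t w).
have sU m : vsqint P (U m).
  apply: vsqintB; first exact: vsqint_y.
  by apply: (vsqint_vmean (F := fun m w => y t w m)) => j; exact: vsqint_y.
have NU0 m : Ex P (fun w => inner (N t m w) (U m w)) = 0.
  apply: (Ex_noise (tT := tT)) => //; apply: vmeasurableB; first exact: pastm_y.
  exact: pastm_ymean.
have iNU m : intble P (fun w => inner (N t m w) (U m w)) by exact: intble_inner.
have iNN m : intble P (fun w => inner (N t m w) (N t m w)) by exact: intble_inner.
pose B w := (1 - gamma t * mu) * disp (X t ^~ w)
  + (- (2 * gamma t) * smean (fun m => inner (N t m w) (U m w))
  + gamma t ^+ 2 * smean (fun m => inner (N t m w) (N t m w))).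
have i1 := intble_disp tT'; have i2 := intble_smean iNU; have i3 := intble_smean iNN.
have j3 := intbleZ (gamma t ^+ 2) i3.
have j2 := intbleZD (- (2 * gamma t)) i2 j3.
have iB : intble P B := intbleZD (1 - gamma t * mu) i1 j2.
apply: (@le_trans _ _ (Ex P B)).
  apply: Ex_le => // [|w]; first exact: intble_disp.
  have -> : X t.+1 ^~ w = fun m => y t w m - gamma t *: N t m w.
    by rewrite /X iterateS /= (negPf Ht).
  rewrite /disp vmeanB vmeanZ.
  have E m : inner (y t w m - gamma t *: N t m w -
        (vmean (y t w) - gamma t *: vmean (N t ^~ w)))
      (y t w m - gamma t *: N t m w - (vmean (y t w) - gamma t *: vmean (N t ^~ w)))
    = inner (U m w) (U m w) + (- (2 * gamma t) * inner (N t m w) (U m w)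
      + (2 * gamma t * inner (U m w) (vmean (N t ^~ w)) + gamma t ^+ 2 *
         inner (N t m w - vmean (N t ^~ w)) (N t m w - vmean (N t ^~ w)))).
    have -> : y t w m - gamma t *: N t m w - (vmean (y t w) - gamma t *: vmean (N t ^~ w))
        = U m w - gamma t *: (N t m w - vmean (N t ^~ w)).
      by rewrite /U (scalerBr (gamma t) (N t m w)) !opprB addrACA [RHS]addrACA
        (addrC (- vmean (y t w))).
    rewrite (inner_sqr_step (U m w)) (innerDl (N t m w)) innerNl.
    by rewrite (innerC (vmean _) (U m w)); ring.
  rewrite (eq_smean E) !smeanD !smeanZ.
  have -> : smean (fun m => inner (U m w) (vmean (N t ^~ w))) = 0.
    by rewrite -inner_vmeanl /U vmeanB vmean_cst// subrr inner0l.
  have h1 := smean_sqr_center M_gt0 (N t ^~ w).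
  have h2 := ler_wpM2l (sqr_ge0 (gamma t)) h1.
  have := dispersion_gradient_step M_gt0 FE gradFE muQ_ge0 muS_ge0 L_gt0
    Q_convex S_convex F_smooth (gamma_ge0 t) (gammaL t) (X t ^~ w).
  rewrite -/(disp (X t ^~ w)) /B -/mu; rewrite /U /y in h2 *; lra.
rewrite /B (ExZD _ i1 j2) (ExZD _ i2 j3) (ExZ _ i3) (Ex_smean iNU) (Ex_smean iNN)
  -/(mean_disp t).
under [X in _ + (_ * X + _) <= _]eq_smean do rewrite NU0.
rewrite smean_cst// mulr0 add0r lerD2l ler_wpM2l ?sqr_ge0//.
rewrite -[leRHS](smean_cst M_gt0); apply: smean_le => m.
exact: (Ex_noise_sqr H gamma x0 f_meas f_diff F_diff oracle_variance zeta_iid).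
Qed.

(** Jensen's inequality for the weighted average of the iterates. *)
Lemma weighted_avg_gap (p : pred nat) (wt : nat -> R) :
  (forall t, p t -> 0 <= wt t) -> 0 < \sum_(0 <= t < T | p t) wt t ->
  ('E_P[fun w => (F (weighted_avg T p wt
       (local_sgd_mean (stoch_grad f) H gamma x0 (fun t m => zeta t m w)))
     - F xstar)%R]
   <= ((\sum_(0 <= t < T | p t) wt t)^-1 *
       \sum_(0 <= t < T | p t) wt t * mean_gap t)%:E)%E.
Proof.
move=> wt0 W0; set W := \sum_(0 <= t < T | p t) wt t in W0 *.
pose Xt w := weighted_avg T p wt (Xb ^~ w).
rewrite -/(fun w => F (Xt w) - F xstar).
(* the weights are extended by zero, to sum over ordinals below [T] *)
pose c t := if p t then wt t else 0.
pose Y w := W^-1 * \sum_(t < T) c t * (F (Xb t w) - F xstar).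
have iY : intble P Y.
  apply: intbleZ; apply: (intble_sum _ (F := fun (t : 'I_T) w => _)) => t.
  by apply: intbleZ; exact: (intble_gap (ltnW (ltn_ord t))).
have XtY w : F (Xt w) - F xstar <= Y w.
  rewrite /Y -(ler_pM2l W0) mulVKf ?gt_eqF//.
  rewrite -(big_mkord predT (fun t => c t * (F (Xb t w) - F xstar))).
  have -> : \sum_(0 <= t < T) c t * (F (Xb t w) - F xstar) =
      \sum_(0 <= t < T | p t) wt t * F (Xb t w) - W * F xstar.
    rewrite /W mulr_suml -sumrB [RHS]big_mkcond; apply: eq_bigr => t _.
    by rewrite /c; case: (p t); rewrite ?mul0r// mulrBr.
  by rewrite mulrBr lerD2r; exact: (breg_jensen _ F_convex).
have sXt : vsqint P Xt.
  apply: vsqintZ; rewrite /=.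
  have E w : \sum_(0 <= t < T | p t) wt t *: Xb t w = \sum_(t < T) c t *: Xb t w.
    rewrite big_mkcond -(big_mkord predT (fun t => c t *: Xb t w)).
    by apply: eq_bigr => t _; rewrite /c; case: (p t); rewrite ?scale0r.
  rewrite (funext E); apply: (vsqint_sum _ (F := fun (t : 'I_T) w => _)) => t.
  by apply: vsqintZ; exact: (vsqint_mean (ltnW (ltn_ord t))).
have iXt : intble P (fun w => F (Xt w) - F xstar).
  apply: intble_le iY _.
    apply: measurable_funB => //.
    apply: (measurable_caratheodory (phi := fun y _ => F y)) => //.
      by move=> w x; exact: differentiable_continuous.
    by move=> i; have [] := sXt i.
  by move=> w; rewrite ger0_norm// subr_ge0.
rewrite expectation_Ex// lee_fin.
apply: le_trans (Ex_le iXt iY XtY) _.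
rewrite /Y ExZ; last first.
  apply: (intble_sum _ (F := fun (t : 'I_T) w => _)) => t.
  by apply: intbleZ; exact: (intble_gap (ltnW (ltn_ord t))).
rewrite (Ex_sum _ (F := fun (t : 'I_T) w => _)); last first.
  by move=> t; apply: intbleZ; exact: (intble_gap (ltnW (ltn_ord t))).
rewrite le_eqVlt; apply/orP; left; apply/eqP; congr (_ * _).
rewrite [RHS]big_mkcond big_mkord; apply: eq_bigr => t _.
rewrite ExZ; last exact: (intble_gap (ltnW (ltn_ord t))).
by rewrite /c; case: (p t); rewrite ?mul0r.
Qed.

End expected_recursion.

(** * Scalar recursions and convergence rates *)

Section scalar_recursions.
Variable R : realType.
Implicit Types (r e a x y : nat -> R).

Lemma contraction_iter r (eta c : R) n : eta <= 1 ->
  (forall t, (t < n)%N -> r t.+1 <= (1 - eta) * r t + eta * c) ->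
  r n - c <= (1 - eta) ^+ n * (r 0%N - c).
Proof.
move=> eta1; elim: n => [|n IH] h; first by rewrite expr0 mul1r.
have {}IH := IH (fun t tn => h t (ltn_trans tn (ltnSn n))).
have q0 : 0 <= 1 - eta by rewrite subr_ge0.
have h1 := ler_wpM2l q0 IH; have h2 := h n (ltnSn n).
by rewrite exprS -mulrA; lra.
Qed.

Lemma contraction_weighted_sum r e (eta al B : R) n : eta < 1 ->
  (forall t, (t < n)%N -> r t.+1 <= (1 - eta) * r t - al * e t + B) ->
  0 <= r n ->
  al * \sum_(0 <= t < n) (1 - eta) ^- t.+1 * e t
  <= r 0%N + B * \sum_(0 <= t < n) (1 - eta) ^- t.+1.
Proof.
move=> eta1 h rn0; have q0 : 0 < 1 - eta by rewrite subr_gt0.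
suff H : (1 - eta) ^- n * r n + al * \sum_(0 <= t < n) (1 - eta) ^- t.+1 * e t
    <= r 0%N + B * \sum_(0 <= t < n) (1 - eta) ^- t.+1.
  by apply: le_trans H; rewrite lerDr mulr_ge0// invr_ge0 exprn_ge0// ltW.
elim: n h {rn0} => [|n IH] h.
  by rewrite !big_nil expr0 invr1 mul1r !mulr0 lexx.
have {}IH := IH (fun t tn => h t (ltn_trans tn (ltnSn n))).
rewrite !big_nat_recr//=.
have := h n (ltnSn n).
have w0 : 0 <= (1 - eta) ^- n.+1 by rewrite invr_ge0 exprn_ge0// ltW.
move=> /(ler_wpM2l w0).
have E : (1 - eta) ^- n.+1 * ((1 - eta) * r n) = (1 - eta) ^- n * r n.
  by rewrite exprSr invfM -mulrA mulKf// gt_eqF.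
rewrite mulrDr mulrBr E; lra.
Qed.

Lemma telescope_sum_le a x y m n : (m <= n)%N ->
  (forall t, (m <= t < n)%N -> a t.+1 <= a t - x t + y t) -> 0 <= a n ->
  \sum_(m <= t < n) x t <= a m + \sum_(m <= t < n) y t.
Proof.
move=> mn h an0.
suff H : a n + \sum_(m <= t < n) x t <= a m + \sum_(m <= t < n) y t.
  by apply: le_trans H; rewrite lerDr.
elim: n mn h {an0} => [|n IH] mn h.
  by move: mn; rewrite leqn0 => /eqP ->; rewrite !big_geq.
case: (ltngtP m n.+1) mn h => // [mn _|-> _] h; last by rewrite !big_geq// addr0.
rewrite !big_nat_recr//=.
have h1 : a n.+1 <= a n - x n + y n by apply: h; rewrite -ltnS mn /=.
have h2 : a n + \sum_(m <= t < n) x t <= a m + \sum_(m <= t < n) y t.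
  by apply: IH => // t /andP[mt tn]; apply: h; rewrite mt ltnW.
lra.
Qed.

Lemma harmonic_sum_le n : \sum_(0 <= j < n) (j.+1%:R^-1 : R) <= 1 + ln n%:R.
Proof.
elim: n => [|n IH]; first by rewrite big_nil ln0// addr0.
case: n IH => [|n] IH; first by rewrite big_nat1 ln1 addr0 invr1.
rewrite big_nat_recr//=.
suff : (n.+2%:R^-1 : R) <= ln n.+2%:R - ln n.+1%:R.
  by move=> h; apply: le_trans (lerD IH h) _; rewrite -addrA subrKC.
have i0 : 0 < (n.+2%:R^-1 : R) by rewrite invr_gt0.
have i1 : (n.+2%:R^-1 : R) < 1 by rewrite invf_lt1// ltr1n.
have /le_ln1Dx : -1 < - (n.+2%:R^-1 : R) by rewrite ltrN2.
have -> : 1 + - (n.+2%:R^-1) = n.+1%:R / n.+2%:R :> R.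
  by rewrite -[n.+1]/(n.+2.-1) -subn1 natrB// mulrBl divff// mul1r.
by rewrite ln_div ?posrE// lerNr opprB.
Qed.

Lemma arith_sum_ge n : n%:R ^+ 2 / 2 <= \sum_(0 <= j < n) (j.+1%:R : R).
Proof.
elim: n => [|n IH]; first by rewrite big_nil expr0n/= mul0r.
rewrite big_nat_recr//= -natr1; lra.
Qed.

End scalar_recursions.

Lemma uphalf_facts n : (2 < n)%N ->
  [/\ (0 < uphalf n <= n)%N, (uphalf n <= n./2.+1)%N, (n = uphalf n + n./2)%N,
      (n <= 3 * n./2)%N & (0 < n./2)%N].
Proof. by move=> n2; split; lia. Qed.

Lemma sum_nat_shift (R : realType) (G : nat -> R) m n :
  \sum_(m <= t < m + n) G (t - m)%N = \sum_(0 <= j < n) G j.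
Proof.
rewrite -{1}[m]add0n big_addn addKn; apply: eq_bigr => j _.
by rewrite addnK.
Qed.

Section rates.
Variables (R : realType) (mu L LS s2 : R) (M K H : nat) (r e V : nat -> R).
Variable s : nat -> R.
Let T := (K * H)%N.
Let kappa := L / mu.
Hypotheses (mu_gt0 : 0 < mu) (muL : mu <= L) (LS_ge0 : 0 <= LS) (s2_ge0 : 0 <= s2).
Hypotheses (M_gt0 : (0 < M)%N) (K_gt0 : (0 < K)%N) (H_gt0 : (0 < H)%N).
Hypothesis s0 : s 0%N = 12 * kappa.
Hypothesis s_incr : forall t, s t <= s t.+1 <= s t + 1.
(** The step sizes, in terms of the inverse step sizes [s]. *)
Let gamma t := 2 / (mu * s t).
Hypothesis r_ge0 : forall t, 0 <= r t.
Hypothesis V_ge0 : forall t, 0 <= V t.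
Hypothesis V0 : V 0%N = 0.
Hypothesis V_sync : forall t, (H %| t.+1)%N -> V t.+1 = 0.
Hypothesis V_step : forall t, (t < T)%N -> ~~ (H %| t.+1)%N ->
  V t.+1 <= (1 - gamma t * mu) * V t + gamma t ^+ 2 * s2.
Hypothesis r_step : forall t, (t < T)%N ->
  r t.+1 <= (1 - gamma t * mu) * r t - 4 / 3 * gamma t * e t
    + 4 / 3 * gamma t * (LS * V t) + gamma t ^+ 2 * (s2 / M%:R).

Let L_gt0 : 0 < L. Proof. exact: lt_le_trans muL. Qed.

Lemma kappa_ge1 : 1 <= kappa.
Proof. by rewrite /kappa ler_pdivlMr// mul1r. Qed.

Lemma s_ge t : 12 * kappa <= s t.
Proof.
elim: t => [|t IH]; first by rewrite s0.
by apply: le_trans IH _; case/andP: (s_incr t).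
Qed.

Let s_ge12 t : 12 <= s t.
Proof. by have := s_ge t; have := kappa_ge1; lra. Qed.

Let s_gt0 t : 0 < s t. Proof. by have := s_ge12 t; lra. Qed.

Let s_pred t : s t <= s t.-1 + 1.
Proof.
by case: t => [|t] /=; [have := s_ge12 0; lra | case/andP: (s_incr t)].
Qed.

Let gamma_mu t : gamma t * mu = 2 / s t.
Proof. by rewrite /gamma; field; rewrite !gt_eqF. Qed.

Lemma s_sqr_pred t : s t ^+ 2 - 2 * s t <= s t.-1 ^+ 2.
Proof.
have h1 : s t - 1 <= s t.-1 by have := s_pred t; lra.
have h0 : 0 <= s t - 1 by have := s_ge12 t; lra.
have : (s t - 1) ^+ 2 <= s t.-1 ^+ 2 by rewrite ler_sqr ?nnegrE//; lra.
by rewrite sqrrB1 -mulr_natl; lra.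
Qed.

(** The squared inverse step size times the dispersion grows by a constant at
    each step, because [(s t - 1) ^+ 2 <= s t.-1 ^+ 2]. *)
Lemma dispersion_growth t : (t <= T)%N ->
  V t * s t.-1 ^+ 2 <= (t %% H)%:R * (4 * s2 / mu ^+ 2).
Proof.
elim: t => [|t IH] tT; first by rewrite V0 mul0r mod0n mul0r.
have {}IH := IH (ltnW tT).
rewrite modnS; case: ifPn => Ht; first by rewrite V_sync// mul0r mul0r.
have s2t : 0 <= s t ^+ 2 by rewrite sqr_ge0.
have := ler_wpM2r s2t (V_step tT Ht).
have -> : ((1 - gamma t * mu) * V t + gamma t ^+ 2 * s2) * s t ^+ 2 =
    V t * (s t ^+ 2 - 2 * s t) + 4 * s2 / mu ^+ 2.
  by rewrite gamma_mu /gamma; field; rewrite !gt_eqF.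
move=> h; rewrite -natr1 mulrDl mul1r /=; apply: le_trans h _; rewrite lerD2r.
apply: le_trans IH; by rewrite ler_wpM2l// s_sqr_pred.
Qed.

Lemma dispersion_bound t : (t <= T)%N ->
  V t <= 5 * s2 * H%:R / mu ^+ 2 / s t ^+ 2.
Proof.
move=> tT; rewrite ler_pdivlMr ?exprn_gt0//.
have h := dispersion_growth tT.
have h1 : (t %% H)%:R * (4 * s2 / mu ^+ 2) <= H%:R * (4 * s2 / mu ^+ 2).
  rewrite ler_wpM2r ?ler_nat; last by rewrite ltnW// ltn_mod.
    by [].
  by rewrite divr_ge0 ?sqr_ge0// mulr_ge0.
have h3 : s t <= 12 / 11 * s t.-1 by have := s_pred t; have := s_ge12 t.-1; lra.
have h4 : s t ^+ 2 <= (12 / 11 * s t.-1) ^+ 2.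
  by have := s_gt0 t; have := s_gt0 t.-1 => a0 a1; rewrite ler_sqr ?nnegrE//; lra.
have h5 := ler_wpM2l (V_ge0 t) h4.
have E : 5 * s2 * H%:R / mu ^+ 2 = 5 / 4 * (H%:R * (4 * s2 / mu ^+ 2)).
  by field; rewrite gt_eqF.
have h6 : 0 <= V t * s t.-1 ^+ 2 by rewrite mulr_ge0// sqr_ge0.
rewrite E; move: h5; rewrite exprMn mulrCA => h5; lra.
Qed.

(* the two noise levels: variance after averaging, and drift over [H] steps *)
Let lam := s2 / M%:R.
Let h := LS * s2 * H%:R.

Let lam_ge0 : 0 <= lam. Proof. by rewrite divr_ge0. Qed.
Let h_ge0 : 0 <= h. Proof. by rewrite /h !mulr_ge0. Qed.

Lemma r_recursion t : (t < T)%N ->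
  r t.+1 <= (1 - gamma t * mu) * r t - 4 / 3 * gamma t * e t
    + (4 / 3 * gamma t * (5 * h / mu ^+ 2 / s t ^+ 2) + gamma t ^+ 2 * lam).
Proof.
move=> tT; apply: le_trans (r_step tT) _; rewrite -!addrA !lerD2l lerD2r.
have g0 : 0 <= 4 / 3 * gamma t by rewrite mulr_ge0// divr_ge0// mulr_ge0 ?ltW.
rewrite ler_wpM2l//.
have := ler_wpM2l LS_ge0 (dispersion_bound (ltnW tT)).
have -> : LS * (5 * s2 * H%:R / mu ^+ 2 / s t ^+ 2) = 5 * h / mu ^+ 2 / s t ^+ 2.
  by rewrite /h; field; rewrite !gt_eqF.
by [].
Qed.

(** The error floor of one step with step size [1 / (6 * L)]. *)
Let B := (6 * L) ^- 2 * lam + 5 / 648 * h / L ^+ 3.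

Lemma r_recursion_const t : (t < T)%N -> s t = 12 * kappa ->
  r t.+1 <= (1 - mu / (6 * L)) * r t - 2 / (9 * L) * e t + B.
Proof.
move=> tT st; have := r_recursion tT; rewrite /gamma st /B.
have -> : 2 / (mu * (12 * kappa)) = (6 * L)^-1.
  by rewrite /kappa; field; rewrite !gt_eqF.
have -> : 4 / 3 * (6 * L)^-1 * (5 * h / mu ^+ 2 / (12 * kappa) ^+ 2) =
    5 / 648 * h / L ^+ 3.
  by rewrite /kappa; field; rewrite !gt_eqF.
have -> : 4 / 3 * (6 * L)^-1 = 2 / (9 * L) by field; rewrite gt_eqF.
by rewrite (mulrC _ mu) exprVn addrA (addrAC _ (5 / 648 * h / L ^+ 3)) -addrA.
Qed.

Let p1 := s2 / (mu * T%:R * M%:R).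
Let p2 := LS * s2 / (mu ^+ 2 * T%:R * K%:R).

Let T_gt0 : 0 < T%:R :> R. Proof. by rewrite ltr0n muln_gt0 K_gt0. Qed.

Let p1E : p1 = lam / (mu * T%:R).
Proof. by rewrite /p1 /lam (mulrC _ M%:R) invfM mulrA. Qed.

Let p2E : p2 = h / (mu * T%:R) ^+ 2.
Proof.
have K0 : K%:R != 0 :> R by rewrite pnatr_eq0 -lt0n.
have H0 : H%:R != 0 :> R by rewrite pnatr_eq0 -lt0n.
rewrite /p2 /h /T natrM; field.
by rewrite K0 H0 gt_eqF.
Qed.

Let p1_ge0 : 0 <= p1. Proof. by rewrite p1E divr_ge0// mulr_ge0// ltW. Qed.
Let p2_ge0 : 0 <= p2. Proof. by rewrite p2E divr_ge0// sqr_ge0. Qed.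

(** The rate for constant step sizes and at most [2 * kappa] steps; the factor
    [expR 2] compensates [expR (- (mu * T / L))], which is at least [expR (- 2)]. *)
Lemma few_steps_rate : (forall t, s t = 12 * kappa) -> T%:R <= 2 * kappa ->
  (\sum_(0 <= t < T) (1 - mu / (6 * L)) ^- t.+1)^-1 *
    \sum_(0 <= t < T) (1 - mu / (6 * L)) ^- t.+1 * e t
  <= 200 * expR 2 * (L * expR (- (mu * T%:R / L)) * r 0%N + p1 + p2).
Proof.
move=> sc T2k; set q := 1 - mu / (6 * L).
have q1 : q <= 1 by rewrite /q gerBl divr_ge0 ?ltW// mulr_gt0.
have q0 : 0 < q.
  by rewrite /q subr_gt0 ltr_pdivrMr ?mulr_gt0// mul1r; have := muL; have := L_gt0; lra.
set W := \sum_(0 <= t < T) _; set S := \sum_(0 <= t < T) _ * e _.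
have hS : 2 / (9 * L) * S <= r 0%N + B * W.
  apply: contraction_weighted_sum => //.
    by rewrite ltr_pdivrMr ?mulr_gt0// mul1r; have := muL; have := L_gt0; lra.
  by move=> t tT; exact: r_recursion_const.
have W1 : 1 <= W.
  have : \sum_(0 <= t < T) 1 <= W.
    by apply: ler_sum => t _; rewrite invf_ge1 ?exprn_gt0// exprn_ile1// ltW.
  apply: le_trans; rewrite sumr_const_nat subn0.
  by rewrite -[1 *+ T]/(T%:R) ler1n -(ltr0n R).
have W0 : 0 < W by exact: lt_le_trans W1.
have hS' : W^-1 * S <= 9 / 2 * L * (r 0%N + B).
  rewrite mulrC ler_pdivrMr//.
  have -> : S = 9 / 2 * L * (2 / (9 * L) * S) by field; rewrite gt_eqF.
  rewrite -[leRHS]mulrA ler_wpM2l//; first by rewrite mulr_ge0// ltW.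
  by apply: le_trans hS _; rewrite [leRHS]mulrDl lerD2r ler_peMr.
apply: le_trans hS' _.
have muT : mu * T%:R <= 2 * L.
  by move: T2k; rewrite /kappa mulrA ler_pdivlMr// mulrC.
have muT0 : 0 < mu * T%:R by rewrite mulr_gt0.
have iL : L^-1 <= 2 / (mu * T%:R).
  by rewrite ler_pdivlMr// mulrC ler_pdivrMr.
have b1 : lam / L <= 2 * p1.
  by rewrite p1E mulrCA ler_wpM2l.
have b2 : h / L ^+ 2 <= 4 * p2.
  have -> : 4 * p2 = h * (2 / (mu * T%:R)) ^+ 2.
    by rewrite p2E; field; rewrite !gt_eqF.
  by rewrite ler_wpM2l// -exprVn ler_sqr// nnegrE ?invr_ge0 ?divr_ge0// ltW.
have BE : 9 / 2 * L * B = lam / L / 8 + 5 / 144 * (h / L ^+ 2).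
  by rewrite /B; field; rewrite gt_eqF.
have e2 : 1 <= expR 2 :> R by rewrite -[leLHS]expR0 ler_expR.
have e2' : 1 <= expR 2 * expR (- (mu * T%:R / L)).
  by rewrite -expRD -[leLHS]expR0 ler_expR subr_ge0 ler_pdivrMr.
have h1 : L * r 0%N <= L * r 0%N * (expR 2 * expR (- (mu * T%:R / L))).
  by rewrite ler_peMr// mulr_ge0// ltW.
have h2 : p1 + p2 <= (p1 + p2) * expR 2 by rewrite ler_peMr// addr_ge0.
have h3 : 0 <= L * r 0%N by rewrite mulr_ge0// ltW.
have h4 := p1_ge0; have h5 := p2_ge0.
have -> : 200 * expR 2 * (L * expR (- (mu * T%:R / L)) * r 0%N + p1 + p2) =
    200 * (L * r 0%N * (expR 2 * expR (- (mu * T%:R / L))) + (p1 + p2) * expR 2).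
  by ring.
rewrite mulrDr BE; lra.
Qed.

Hypothesis e_ge0 : forall t, 0 <= e t.

Let u := lam / mu.
Let v := h / mu ^+ 2.
Let t0 := uphalf T.

Hypothesis T_gt : 2 * kappa < T%:R.
Hypothesis s_const : forall t, t%:R <= T%:R / 2 :> R -> s t = 12 * kappa.
Hypothesis s_linear : forall t, T%:R / 2 <= t%:R :> R ->
  s t = 12 * kappa - T%:R / 2 + t%:R.

Let T_gt2 : (2 < T)%N.
Proof. by rewrite -(ltr_nat R); apply: le_lt_trans T_gt; have := kappa_ge1; lra. Qed.

Lemma half_le t : (T%:R / 2 <= t%:R :> R) = (t0 <= t)%N.
Proof. by rewrite ler_pdivrMr// -natrM ler_nat muln2 leq_uphalf_double. Qed.

Lemma le_half t : (t%:R <= T%:R / 2 :> R) = (t <= T./2)%N.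
Proof. by rewrite ler_pdivlMr// -natrM ler_nat muln2 -geq_half_double. Qed.

Let t0_half t : (t < t0)%N -> s t = 12 * kappa.
Proof.
move=> tt0; apply: s_const; rewrite le_half -ltnS.
by apply: leq_trans tt0 _; have [_ ->] := uphalf_facts T_gt2.
Qed.

Let t0_gt0 : (0 < t0)%N. Proof. by have [/andP[]] := uphalf_facts T_gt2. Qed.
Let t0_leT : (t0 <= T)%N. Proof. by have [/andP[]] := uphalf_facts T_gt2. Qed.

(** The first phase contracts the squared distance exponentially. *)
Lemma first_phase :
  r t0 <= expR (- (12^-1 * (mu * T%:R / L))) * r 0%N + B * (6 * L / mu).
Proof.
set q := mu / (6 * L); set c := B * (6 * L / mu).
have q0 : 0 <= q by rewrite divr_ge0 ?ltW// mulr_gt0.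
have qc : q * c = B by rewrite /q /c; field; rewrite !gt_eqF.
have q1 : q <= 1.
  by rewrite ler_pdivrMr ?mulr_gt0// mul1r; have := muL; have := L_gt0; lra.
have B0 : 0 <= B.
  have x1 : 0 <= (6 * L) ^- 2 * lam by rewrite mulr_ge0// invr_ge0 sqr_ge0.
  have x2 : 0 <= h / L ^+ 3 by rewrite divr_ge0// exprn_ge0// ltW.
  rewrite /B -mulrA; move: (h / _) x1 x2 => z x1 x2; lra.
have c0 : 0 <= c by rewrite mulr_ge0// divr_ge0 ?mulr_ge0// ltW.
have := @contraction_iter R r q c t0 q1.
have hr t : (t < t0)%N -> r t.+1 <= (1 - q) * r t + q * c.
  move=> tt0; rewrite qc.
  apply: le_trans (r_recursion_const (leq_trans tt0 t0_leT) (t0_half tt0)) _.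
  by rewrite lerD2r gerBl mulr_ge0// divr_ge0// mulr_ge0// ltW.
move=> /(_ hr); rewrite lerBlDr => /le_trans; apply; rewrite lerD2r.
have qt0 : 0 <= (1 - q) ^+ t0 by rewrite exprn_ge0// subr_ge0.
apply: (@le_trans _ _ ((1 - q) ^+ t0 * r 0%N)).
  by rewrite ler_wpM2l// gerBl.
rewrite ler_wpM2r//.
apply: (@le_trans _ _ (expR (- q) ^+ t0)).
  by rewrite lerXn2r ?nnegrE ?expR_ge0 ?subr_ge0// expR_ge1Dx.
rewrite -expRM_natl ler_expR mulrN lerN2.
have h0 : T%:R / 2 <= t0%:R :> R by rewrite half_le.
have := ler_wpM2r q0 h0.
have -> : T%:R / 2 * q = 12^-1 * (mu * T%:R / L).
  by rewrite /q; field; rewrite gt_eqF.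
by [].
Qed.

(** The potential [mu / 2 * s t.-1 ^+ 2 * r t] telescopes in the second phase. *)
Lemma second_phase :
  4 / 3 * \sum_(t0 <= t < T) s t * e t
  <= 72 * mu * kappa ^+ 2 * r t0
     + (20 / 3 * v * \sum_(t0 <= t < T) (s t)^-1 + T%:R * (2 * u)).
Proof.
pose a t := mu / 2 * s t.-1 ^+ 2 * r t.
have at0 : a t0 = 72 * mu * kappa ^+ 2 * r t0.
  rewrite /a t0_half; last by rewrite prednK.
  by field.
have hn : \sum_(t0 <= t < T) (2 * u) <= T%:R * (2 * u).
  rewrite sumr_const_nat -[leLHS]mulr_natl ler_wpM2r//; last by rewrite ler_nat leq_subr.
  by rewrite mulr_ge0// divr_ge0// ltW.
apply: (@le_trans _ _ (a t0 + \sum_(t0 <= t < T) (20 / 3 * v * (s t)^-1 + 2 * u))).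
  rewrite mulr_sumr; apply: telescope_sum_le => //; last first.
    by rewrite /a mulr_ge0// mulr_ge0 ?sqr_ge0// divr_ge0// ltW.
  move=> t /andP[_ tT]; rewrite /a /=.
  have c0 : 0 <= mu / 2 * s t ^+ 2 by rewrite mulr_ge0 ?sqr_ge0// divr_ge0// ltW.
  have := ler_wpM2l c0 (r_recursion tT).
  have -> : mu / 2 * s t ^+ 2 * ((1 - gamma t * mu) * r t - 4 / 3 * gamma t * e t
    + (4 / 3 * gamma t * (5 * h / mu ^+ 2 / s t ^+ 2) + gamma t ^+ 2 * lam)) =
    mu / 2 * (s t ^+ 2 - 2 * s t) * r t - 4 / 3 * (s t * e t)
    + (20 / 3 * v * (s t)^-1 + 2 * u).
    by rewrite gamma_mu /gamma /v /u; field; rewrite !gt_eqF.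
  move=> /le_trans; apply; rewrite !lerD2r ler_wpM2r// ler_wpM2l//.
    by rewrite divr_ge0// ltW.
  exact: s_sqr_pred.
rewrite at0 lerD2l big_split/= -mulr_sumr lerD2l.
exact: hn.
Qed.

Let W := \sum_(t0 <= t < T) s t.

Let nE : T = (t0 + T./2)%N. Proof. by have [] := uphalf_facts T_gt2. Qed.
Let sum_half (G : nat -> R) :
  \sum_(t0 <= t < T) G (t - t0)%N = \sum_(0 <= j < T./2) G j.
Proof. by rewrite -(sum_nat_shift G t0) -nE. Qed.
Let n_ge : T%:R <= 3 * (T./2)%:R :> R.
Proof. by rewrite -natrM ler_nat; have [] := uphalf_facts T_gt2. Qed.

Let s_ge_shift t : (t0 <= t)%N -> (t - t0).+1%:R <= s t.
Proof.
move=> t0t; rewrite s_linear ?half_le// -natr1 natrB//.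
have h1 : (t0%:R : R) >= T%:R / 2 by rewrite half_le.
by have := kappa_ge1; lra.
Qed.

Lemma weight_ge_linear : 4 * kappa * T%:R <= W.
Proof.
apply: (@le_trans _ _ (\sum_(t0 <= t < T) 12 * kappa)).
  rewrite sumr_const_nat {2}nE addKn -[leRHS]mulr_natl.
  have k0 : 0 <= kappa by have := kappa_ge1; lra.
  have := ler_wpM2l k0 n_ge; lra.
by apply: ler_sum => t _; exact: s_ge.
Qed.

Lemma weight_ge_square : T%:R ^+ 2 / 18 <= W.
Proof.
apply: (@le_trans _ _ (\sum_(t0 <= t < T) (t - t0).+1%:R)); last first.
  by rewrite /W !big_seq; apply: ler_sum => t; rewrite mem_index_iota => /andP[/s_ge_shift].
rewrite (sum_half (fun j => j.+1%:R)).
apply: le_trans (arith_sum_ge _ _).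
have : T%:R ^+ 2 <= (3 * (T./2)%:R) ^+ 2 :> R by rewrite ler_sqr ?nnegrE// mulr_ge0.
by rewrite exprMn; lra.
Qed.

Lemma inverse_weights_sum : \sum_(t0 <= t < T) (s t)^-1 <= 1 + ln T%:R.
Proof.
apply: (@le_trans _ _ (\sum_(t0 <= t < T) (t - t0).+1%:R^-1)).
  rewrite !big_seq; apply: ler_sum => t; rewrite mem_index_iota => /andP[t0t _].
  by rewrite lef_pV2 ?posrE// s_ge_shift.
rewrite (sum_half (fun j => j.+1%:R^-1)).
have [_ _ _ _ n0] := uphalf_facts T_gt2.
have N0 : (0 < T)%N by rewrite -(ltr0n R).
apply: le_trans (harmonic_sum_le _ _) _.
by rewrite lerD2l ler_ln ?posrE ?ltr0n// ler_nat {2}nE leq_addl.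
Qed.

(** The rate for more than [2 * kappa] steps; the sum of the weights dominates
    both [kappa * T] and [T ^+ 2]. *)
Lemma many_steps_rate :
  W^-1 * \sum_(t0 <= t < T) s t * e t
  <= 200 * (1 + ln T%:R) *
     (L * expR (- (12^-1 * (mu * T%:R / L))) * r 0%N + p1 + p2).
Proof.
set E := expR _; set A := 1 + ln _; set S := \sum_(t0 <= t < T) s t * e t.
have A1 : 1 <= A by rewrite lerDl ln_ge0// ler1n -(ltr0n R).
have k1 := kappa_ge1; have k0 : 0 < kappa by lra.
have W1 := weight_ge_linear; have W2 := weight_ge_square.
have W0 : 0 < W.
  by apply: lt_le_trans W1; apply: mulr_gt0 => //; apply: mulr_gt0.
have u0 : 0 <= u by rewrite divr_ge0// ltW.
have v0 : 0 <= v by rewrite divr_ge0// sqr_ge0.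
have E0 : 0 <= E * r 0%N by rewrite mulr_ge0// expR_ge0.
have hp1 : p1 = u / T%:R by rewrite p1E /u invfM mulrA.
have hp2 : p2 = v / T%:R ^+ 2 by rewrite p2E /v exprMn invfM mulrA.
have f1 : 4 * kappa * u <= W * p1.
  by rewrite hp1 (mulrC _ u) [leRHS]mulrCA ler_wpM2l// ler_pdivlMr.
have f2 : T%:R * u / 18 <= W * p1.
  rewrite hp1 (mulrC _ u) -[leLHS]mulrA [leRHS]mulrCA ler_wpM2l// ler_pdivlMr//.
  by rewrite mulrAC -expr2.
have f3 : v / 18 <= W * p2.
  by rewrite hp2 [leRHS]mulrCA ler_wpM2l// ler_pdivlMr ?exprn_gt0// mulrC.
have f4 : 8 * (mu * kappa ^+ 2) <= W * L.
  have : 8 * kappa ^+ 2 <= W.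
    by apply: le_trans W1; have := ler_wpM2l (ltW k0) (ltW T_gt); lra.
  move=> /(ler_wpM2l (ltW mu_gt0)); have := ler_wpM2l (ltW W0) muL; lra.
have fB : 72 * mu * kappa ^+ 2 * (B * (6 * L / mu)) = 12 * kappa * u + 10 / 3 * v.
  by rewrite /B /u /v /kappa; field; rewrite !gt_eqF.
have c0 : 0 <= 72 * mu * kappa ^+ 2 by rewrite mulr_ge0 ?sqr_ge0// mulr_ge0// ltW.
have h1 := ler_wpM2l c0 first_phase; rewrite -/E mulrDr fB in h1.
have h2 := ler_wpM2l v0 inverse_weights_sum; rewrite -/A in h2.
have h3 := second_phase; rewrite -/S in h3.
have h4 := ler_wpM2r E0 f4.
have Am : 0 <= A - 1 by rewrite subr_ge0.
have h5 := ler_wpM2l Am f3.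
have p1' := p1_ge0; have p2' := p2_ge0.
have Wp1 : 0 <= W * p1 by rewrite mulr_ge0// ltW.
have Wp2 : 0 <= W * p2 by rewrite mulr_ge0// ltW.
have WE : 0 <= W * (L * (E * r 0%N)).
  by apply: mulr_ge0; [exact: ltW | apply: mulr_ge0 => //; exact: ltW].
have j1 := mulr_ge0 Am Wp1; have j2 := mulr_ge0 Am Wp2; have j3 := mulr_ge0 Am WE.
rewrite mulrC ler_pdivrMr//.
lra.
Qed.

End rates.

(** * Local SGD *)

(* C is the constant of O(.); C * (1 + ln T) ^+ p is the factor of O~(.);
   c is the constant in the exponent under O~(.). All three are universal. *)
Theorem theorem1 (R : realType) :
  exists (C c : R) (p : nat), 0 < C /\ 0 < c /\
  forall (d : nat) (dZ dO : measure_display)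
    (Z : measurableType dZ) (Omega : measurableType dO)
    (D : probability Z R) (P : probability Omega R)
    (f : 'rV[R]_d -> Z -> R) (F : 'rV[R]_d -> R)
    (muQ LQ muR LR L sigma : R) (M K H : nat)
    (x0 xstar : 'rV[R]_d) (zeta : nat -> 'I_M -> {RV P >-> Z}),
  let mu := muQ + muR in
  let kappa := L / mu in
  let eps := LR / L in
  let T := (K * H)%N in
  let xbar (gamma : nat -> R) (omega : Omega) :=
    local_sgd_mean (stoch_grad f) H gamma x0 (fun t m => zeta t m omega) in
  (0 < d)%N -> (0 < M)%N -> (0 < K)%N -> (0 < H)%N ->
  expected_objective D f F ->
  eps_decomposition F muQ LQ muR LR L ->
  0 < mu ->
  stochastic_oracle D f F sigma 0 ->
  (forall x, F xstar <= F x) ->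
  iid_draws D T zeta ->
  (T%:R <= 2 * kappa ->
   ('E_P[fun omega : Omega =>
      (F (weighted_avg T xpredT (weight_const mu L)
           (xbar (gamma_const L) omega)) - F xstar)%R]
    <= (C * (L * expR (- (mu * T%:R / L)) * enorm (x0 - xstar) ^+ 2
             + sigma ^+ 2 / (mu * T%:R * M%:R)
             + eps * L * sigma ^+ 2 / (mu ^+ 2 * T%:R * K%:R)))%R%:E)%E)
  /\
  (2 * kappa < T%:R ->
   ('E_P[fun omega : Omega =>
      (F (weighted_avg T (fun t => T%:R / 2 <= t%:R :> R) (weight_dec mu L T)
           (xbar (gamma_dec mu L T) omega)) - F xstar)%R]
    <= (C * (1 + ln T%:R) ^+ p
          * (L * expR (- (c * (mu * T%:R / L))) * enorm (x0 - xstar) ^+ 2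
             + sigma ^+ 2 / (mu * T%:R * M%:R)
             + eps * L * sigma ^+ 2 / (mu ^+ 2 * T%:R * K%:R)))%R%:E)%E).
Proof.
exists (200 * expR 2), 12^-1, 1%N.
split; first by rewrite mulr_gt0// expR_gt0.
split; first by rewrite invr_gt0.
move=> d dZ dO Z Omega D P f F muQ LQ muR LR L sigma M K H x0 xstar zeta mu kappa
  eps T xbar d0 M0 K0 H0 objF dec mu0 oracle Fmin iid.
case: dec => Qf [S [FE [Qq Qsc Qsm] [Ssc Ssm] Fsm]].
case: oracle => f_diff or_mean or_var.
have f_meas x : measurable_fun setT (f x).
  by have [/integrableP[/measurable_EFinP]] := objF x.
have F_diff x : differentiable F x by case: Fsm.
have oracle_mean x i :
    D.-integrable setT (EFin \o (fun z => stoch_grad f x z 0 i)) /\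
    (\int[D]_z (stoch_grad f x z 0 i)%:E = (gradient F x 0 i)%:E)%E.
  by have [iG EG] := or_mean x i; split=> //; rewrite -EG unlock.
have oracle_variance x :
    (\int[D]_z (inner (stoch_grad f x z - gradient F x)
       (stoch_grad f x z - gradient F x))%:E <= (sigma ^+ 2)%:E)%E.
  have := or_var x; rewrite mul0r addr0 unlock.
  by under eq_integral do rewrite enorm_sqr.
have gradFE x : gradient F x = gradient Qf x + gradient S x.
  rewrite (funext FE : F = fun y => Qf y + S y).
  by apply: gradientD; [case: Qsm | case: Ssm].
have [muQ0 _ Qsc'] := Qsc; have [muR0 _ Ssc'] := Ssc.
have Q_convex x y : muQ / 2 * inner (x - y) (x - y) <= breg Qf x y.
  by rewrite -enorm_sqr; exact: Qsc'.
have S_convex x y : muR / 2 * inner (x - y) (x - y) <= breg S x y.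
  by rewrite -enorm_sqr; exact: Ssc'.
have S_smooth x y : breg S x y <= LR / 2 * inner (x - y) (x - y).
  by rewrite -enorm_sqr; case: Ssm => _; exact.
have F_smooth x y : breg F x y <= L / 2 * inner (x - y) (x - y).
  by rewrite -enorm_sqr; case: Fsm => _; exact.
(* the constants are compared along a unit vector, which needs [0 < d] *)
pose v : 'rV[R]_d := delta_mx 0 (Ordinal d0).
have v1 : inner (v - 0) (v - 0) = 1.
  by rewrite subr0 inner_delta /v mxE !eqxx.
have muL : mu <= L.
  have := le_trans (F_strongly_convex FE gradFE Q_convex S_convex v 0) (F_smooth v 0).
  by rewrite v1 /mu; lra.
have LR0 : 0 <= LR.
  have := le_trans (S_convex v 0) (S_smooth v 0).
  by rewrite v1; lra.
have L0 : 0 < L by exact: lt_le_trans muL.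
have k0 : 0 < kappa by rewrite divr_gt0.
have epsL : eps * L = LR by rewrite /eps divfK// gt_eqF.
have s2 : 0 <= sigma ^+ 2 by exact: sqr_ge0.
have T0 : 0 < T%:R :> R by rewrite ltr0n muln_gt0 K0.
rewrite epsL enorm_sqr.
(* step sizes in terms of the inverse step sizes [s] *)
pose gm (s : nat -> R) t := 2 / (mu * s t).
have gm_ok s : (forall t, 12 * kappa <= s t) ->
    (forall t, 0 <= gm s t) /\ (forall t, 6 * (gm s t * L) <= 1).
  move=> hs; have s0 t : 0 < s t by apply: lt_le_trans (hs t); rewrite mulr_gt0.
  split=> t; first by rewrite divr_ge0// mulr_ge0// ltW.
  have -> : 6 * (gm s t * L) = 12 * kappa / s t.
    by rewrite /gm /kappa; field; rewrite !gt_eqF.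
  by rewrite ler_pdivrMr// mul1r.
have disp_ge0 s t : 0 <= mean_disp H f (gm s) x0 zeta t.
  by apply: Ex_ge0 => w; apply: smean_ge0 => m; exact: inner_ge0.
have dist_ge0 s t : 0 <= mean_sqr_dist H f xstar (gm s) x0 zeta t.
  by apply: Ex_ge0 => w; exact: inner_ge0.
split=> hT.
- pose s (t : nat) : R := 12 * kappa.
  have gE : gamma_const L = gm s.
    by apply/funext => t; rewrite /gamma_const /gm /s /kappa; field; rewrite !gt_eqF.
  have [g0 gL] := gm_ok s (fun=> lexx _).
  have q0 : 0 < 1 - mu / (6 * L).
    by rewrite subr_gt0 ltr_pdivrMr ?mulr_gt0// mul1r; lra.
  have w0 t : 0 < weight_const mu L t by rewrite invr_gt0 exprn_gt0.
  have W0 : 0 < \sum_(0 <= t < T) weight_const mu L t.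
    have T1 : (0 < T)%N by rewrite -(ltr0n R).
    rewrite -(prednK T1) big_nat_recl//= ltr_pwDl//.
    by apply: sumr_ge0 => t _; rewrite ltW.
  rewrite /xbar gE.
  apply: le_trans (weighted_avg_gap H (gm s) x0 f_meas f_diff F_diff oracle_variance
    iid FE gradFE muQ0 muR0 L0 Q_convex S_convex F_smooth Fmin
    (fun t _ => ltW (w0 t)) W0) _.
  rewrite lee_fin -(mean_sqr_dist0 H f xstar (gm s) x0 zeta M0).
  apply: (few_steps_rate mu0 muL LR0 s2 K0 H0 (s := s)
    (V := mean_disp H f (gm s) x0 zeta)) => //.
  + by move=> t; rewrite lexx lerDl ler01.
  + exact: mean_disp0.
  + by move=> t; exact: mean_disp_sync.
  + move=> t tT Ht.
    exact: (mean_disp_step xstar x0 M0 f_meas f_diff F_diff oracle_mean oracle_variance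
      iid FE gradFE muQ0 muR0 L0 Q_convex S_convex F_smooth g0 gL tT Ht).
  + move=> t tT.
    exact: (mean_sqr_dist_step H x0 M0 f_meas f_diff F_diff oracle_mean oracle_variance
      iid FE gradFE Qq muQ0 muR0 L0 Q_convex S_convex S_smooth F_smooth Fmin g0 gL tT).
(* the inverse step sizes are constant up to [T / 2], then grow linearly *)
pose s (t : nat) : R := 12 * kappa + Num.max 0 (t%:R - T%:R / 2).
have s_const t : t%:R <= T%:R / 2 :> R -> s t = 12 * kappa.
  by move=> tT; rewrite /s max_l ?addr0// subr_le0.
have s_linear t : T%:R / 2 <= t%:R :> R -> s t = 12 * kappa - T%:R / 2 + t%:R.
  by move=> tT; rewrite /s max_r ?subr_ge0// addrA addrAC.
have hs t : 12 * kappa <= s t by rewrite lerDl le_max lexx.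
have s_incr t : s t <= s t.+1 <= s t + 1.
  rewrite /s -addrA !lerD2l -[t.+1%:R]natr1; apply/andP; split.
    by rewrite ge_max !le_max lexx/=; apply/orP; right; lra.
  rewrite ge_max; apply/andP; split.
    by rewrite addr_ge0// le_max lexx.
  have : t%:R - T%:R / 2 <= Num.max 0 (t%:R - T%:R / 2) :> R.
    by rewrite le_max lexx orbT.
  by rewrite -(lerD2r 1) [leLHS]addrAC.
have [g0 gL] := gm_ok s hs.
have gE : gamma_dec mu L T = gm s.
  apply/funext => t; rewrite /gamma_dec; case: ifPn => [tT|].
    by rewrite /gm s_const// /kappa; field; rewrite !gt_eqF.
  rewrite -ltNge => /ltW tT; rewrite /gm s_linear//.
  by rewrite /xi_dec /kappa mulrA.
have wE t : T%:R / 2 <= t%:R :> R -> weight_dec mu L T t = s t.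
  by move=> tT; rewrite s_linear// /weight_dec /xi_dec /kappa mulrA.
have sumE (G : nat -> R) : \sum_(0 <= t < T | T%:R / 2 <= t%:R :> R) G t =
    \sum_(uphalf T <= t < T) G t.
  rewrite [RHS](big_nat_widenl _ 0)//; apply: eq_bigl => t.
  by rewrite ler_pdivrMr// -natrM ler_nat muln2 leq_uphalf_double.
have s_gt0 t : 0 < s t by apply: lt_le_trans (hs t); rewrite mulr_gt0.
have w0 t : T%:R / 2 <= t%:R :> R -> 0 <= weight_dec mu L T t.
  by move=> tT; rewrite wE// ltW.
have WE : \sum_(0 <= t < T | T%:R / 2 <= t%:R :> R) weight_dec mu L T t =
    \sum_(uphalf T <= t < T) s t.
  by rewrite -sumE; apply: eq_bigr => t; exact: wE.
have T2 : (2 < T)%N.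
  have k1 : 1 <= kappa by rewrite ler_pdivlMr// mul1r.
  by rewrite -(ltr_nat R); apply: le_lt_trans hT; lra.
have W0 : 0 < \sum_(0 <= t < T | T%:R / 2 <= t%:R :> R) weight_dec mu L T t.
  rewrite WE; have [/andP[h0 _] h1 hn _ h3] := uphalf_facts T2.
  rewrite big_ltn; last by rewrite {2}hn -[X in (X < _)%N]addn0 ltn_add2l.
  by rewrite ltr_pwDl//; apply: sumr_ge0 => t _; rewrite ltW.
rewrite /xbar gE.
apply: le_trans (weighted_avg_gap H (gm s) x0 f_meas f_diff F_diff oracle_variance
  iid FE gradFE muQ0 muR0 L0 Q_convex S_convex F_smooth Fmin w0 W0) _.
rewrite lee_fin WE -(mean_sqr_dist0 H f xstar (gm s) x0 zeta M0).
pose e := mean_gap H f F xstar (gm s) x0 zeta.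
have SE : \sum_(0 <= t < T | T%:R / 2 <= t%:R :> R) weight_dec mu L T t * e t =
    \sum_(uphalf T <= t < T) s t * e t.
  by rewrite -sumE; apply: eq_bigr => t tT; rewrite wE.
rewrite SE.
have T1 : 1 <= T%:R :> R by rewrite ler1n -(ltr0n R).
apply: (@le_trans _ _ (200 * (1 + ln T%:R) *
   (L * expR (- (12^-1 * (mu * T%:R / L))) * mean_sqr_dist H f xstar (gm s) x0 zeta 0
    + sigma ^+ 2 / (mu * T%:R * M%:R) + LR * sigma ^+ 2 / (mu ^+ 2 * T%:R * K%:R)))).
  apply: (many_steps_rate mu0 muL LR0 s2 K0 H0 (s := s)
    (V := mean_disp H f (gm s) x0 zeta)) => //.
  + apply: s_const; exact: ltW (divr_gt0 T0 _).
  + exact: mean_disp0.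
  + by move=> t; exact: mean_disp_sync.
  + move=> t tT Ht.
    exact: (mean_disp_step xstar x0 M0 f_meas f_diff F_diff oracle_mean oracle_variance
      iid FE gradFE muQ0 muR0 L0 Q_convex S_convex F_smooth g0 gL tT Ht).
  + move=> t tT.
    exact: (mean_sqr_dist_step H x0 M0 f_meas f_diff F_diff oracle_mean oracle_variance
      iid FE gradFE Qq muQ0 muR0 L0 Q_convex S_convex S_smooth F_smooth Fmin g0 gL tT).
  + by move=> t; exact: mean_gap_ge0.
have mT0 : 0 <= mu * T%:R by rewrite mulr_ge0// ltW.
have a1 : 0 <= L * expR (- (12^-1 * (mu * T%:R / L))).
  by apply: mulr_ge0; [exact: ltW | exact: expR_ge0].
have a2 : 0 <= sigma ^+ 2 / (mu * T%:R * M%:R) by rewrite divr_ge0// mulr_ge0.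
have a3 : 0 <= LR * sigma ^+ 2 / (mu ^+ 2 * T%:R * K%:R).
  apply: divr_ge0; first exact: mulr_ge0.
  by rewrite mulr_ge0// mulr_ge0 ?sqr_ge0// ltW.
rewrite expr1 ler_wpM2r//; first by rewrite addr_ge0// addr_ge0// mulr_ge0.
apply: ler_wpM2r; first by rewrite addr_ge0// ln_ge0.
by rewrite ler_peMr// -[leLHS]expR0 ler_expR.
Qed.
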